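(* Let $k=2$, and let $G^{(2)}$ be the graph with three terminals $T_1,T_2,T_3$ attached to $t_1,t_2,t_3\in V(G_1)$, as defined in the context. Let $a,b\in V(G_1)$ be vertices on the boundary $\partial G_1$ such that there are no terminals in between, and let $\partial C$ be the set of vertices of $\partial G_1$ which lie between $a$ and $b$. Suppose the two impurities are placed at locations $I^{(1)}=(I^{(1)}_1,I^{(1)}_2)$, $I^{(2)}=(I^{(2)}_1,I^{(2)}_2)$ satisfying $I^{(1)}_1=a$, $I^{(2)}_1=b$ and $I^{(j)}_2\in\partial G_2$, $j=1,2$. Then the number $M(a,b)$ of the corresponding perfect matchings of $G^{(2)}$ is $$M(a,b)=A(a,b):=\left|\det\begin{pmatrix} L_{a,t_1}&L_{a,t_2}&L_{a,t_3}\\ L_{\partial C,t_1}&L_{\partial C,t_2}&L_{\partial C,t_3}\\ L_{b,t_1}&L_{b,t_2}&L_{b,t_3}\end{pmatrix}\det(K)\right|,$$ where $L_{x,t_i}=(K^{-1})(x,t_i)$ for $x=a,b$, and $L_{\partial C,t_i}=\sum_{y\in\partial C}(K^{-1})(y,t_i)$, $i=1,2,3$.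
   Context: $G_2$ is a finite subgraph of the square lattice and $G_1$ is its dual graph: the vertices of $G_1$ are the bounded faces (unit squares) of $G_2$, two being adjacent iff the faces share an edge. $\partial G_2$ is the set of vertices of $G_2$ on the outer boundary, and $\partial G_1$ is the set of vertices of $G_1$ whose face is incident with an outer boundary edge of $G_2$. For $k\ge1$, $G_{1,T}$ is the graph obtained from $G_1$ by adding $2k-1$ vertices $T_1,\dots,T_{2k-1}$ (terminals) to the boundary of $G_1$: $T_i$ lies in the outer face of $G_2$ and is joined to a vertex $t_i\in\partial G_1$ by an edge crossing an outer boundary edge $f_i$ of $G_2$. The graph $G^{(k)}$ is obtained by superimposing $G_2$ and $G_{1,T}$, extending further edges from the vertices of $\partial G_1$ across the remaining outer boundary edges, placing a vertex wherever two edges meet, and adding diagonal edges. Explicitly, its vertex set is $V(G_1)\cup\{T_i\}\cup V(G_2)\cup\{m_e:e\in E(G_2)\}$, and its edges are: $m_e$ is joined to both endpoints of $e$ and to each bounded face incident with $e$; $m_{f_i}$ is joined to $T_i$; (diagonal edges) each $x\in V(G_1)$ is joined to the four corners of its face in $V(G_2)$, and each $T_i$ is joined to the two endpoints of $f_i$. A perfect matching is a set of edges covering each vertex exactly once. An impurity of a perfect matching of $G^{(k)}$ is an edge of the matching joining a vertex of $G_{1,T}$ to a vertex of $G_2$; every perfect matching has exactly $k$ impurities. The location of an impurity is written $I=(I_1,I_2)$ with $I_1$ in $G_{1,T}$ and $I_2\in V(G_2)$. ''No terminals in between'' means that one of the two portions of the boundary running from $a$ to $b$ carries no terminal; the vertices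 ''between $a$ and $b$'' are those of this portion, other than $a$ and $b$. $K$ is the matrix indexed by $V(G_1)$ with $K(x,x)=4$, $K(x,y)=-1$ if $x,y$ are adjacent in $G_1$, and $K(x,y)=0$ otherwise.
   Formalization: The sum over ∂C counts a face once per outer boundary edge it has on the portion (corner squares twice), and the terminal-free portion runs along the boundary walk from I_2^(1) to I_2^(2); with a plain set, or a portion from a to b away from the impurities, the formula fails. *)

(* Defs.v *)
From HB Require Import structures.
From mathcomp Require Import all_boot all_order all_algebra finmap.

Set Implicit Arguments.
Unset Strict Implicit.
Unset Printing Implicit Defensive.

Import Order.TTheory GRing.Theory Num.Theory.
Local Open Scope ring_scope.

(* A point of the square lattice; a unit square of the lattice is named by its
   lower-left corner. *)
Definition point : Type := (int * int)%type.
Definition ex : point := (1, 0).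
Definition ey : point := (0, 1).

Definition corners (c : point) : seq point :=
  [:: c; c + ex; c + ey; c + ex + ey].
Definition sides (c : point) : seq (point * point) :=
  [:: (c, c + ex); (c, c + ey); (c + ey, c + ey + ex); (c + ex, c + ex + ey)].

(* A finite subgraph G_2 of the square lattice; each edge is stored once,
   directed to the right or upwards. *)
Record lattice_graph := LatticeGraph {
  verts : {fset point};
  edges : {fset point * point};
  edges_unit : forall e, e \in edges -> (e.2 == e.1 + ex) || (e.2 == e.1 + ey);
  edges_ends : forall e, e \in edges -> (e.1 \in verts) && (e.2 \in verts) }.

Section PlaneGraph.
Variable G : lattice_graph.

Definition linked : rel point :=
  fun p q => ((p, q) \in edges G) || ((q, p) \in edges G).

Definition connected_graph : Prop :=
  forall p q, p \in verts G -> q \in verts G ->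
  exists s, path linked p s /\ last p s = q.

(* A face of the plane graph is a union of lattice squares, glued along the
   lattice edges that do not belong to the graph. *)
Definition glued : rel point :=
  fun c c' => has (fun e => (e \in sides c') && (e \notin edges G)) (sides c).
Definition same_face (c c' : point) : Prop :=
  exists s, path glued c s /\ last c s = c'.
Definition in_bounded_face (c : point) : Prop :=
  exists B : {fset point}, forall c', same_face c c' -> c' \in B.
Definition bounded_faces_are_squares : Prop :=
  forall c, in_bounded_face c -> forall c', same_face c c' -> c' = c.

(* V(G_1).  When the bounded faces are unit squares, these are all of them and
   every other square lies in the outer face. *)
Definition faces : {fset point} :=
  [fset c in verts G | all (fun e => e \in edges G) (sides c)]%fset.

Definition face_adj (x y : faces) : bool :=
  (x != y) && has (fun e => e \in sides (val y)) (sides (val x)).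

(* A dart (p, q) is an edge with a direction of travel. *)
Definition turn_left (d : point) : point := (- d.2, d.1).
Definition rev_dart (d : point * point) : point * point := (d.2, d.1).
Definition left_cell (d : point * point) : point :=
  let o := d.2 + turn_left (d.2 - d.1) in (Num.min d.1.1 o.1, Num.min d.1.2 o.2).
Definition right_cell (d : point * point) : point := left_cell (rev_dart d).

Definition outer_edge (e : point * point) : bool :=
  (e \in edges G) && ((left_cell e \notin faces) || (right_cell e \notin faces)).
(* membership in \partial G_2 *)
Definition outer_vertex (p : point) : bool :=
  (p \in verts G) &&
  has (fun c => c \notin faces) [:: p; p - ex; p - ey; p - ex - ey].
(* membership in \partial G_1 *)
Definition boundary_face (x : faces) : bool := has outer_edge (sides (val x)).

(* The boundary of the outer face is walked with that face on the left: at each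
   vertex the next edge is the leftmost one present. *)
Definition outer_dart (d : point * point) : bool :=
  linked d.1 d.2 && (left_cell d \notin faces).
Definition next_dart (d : point * point) : point * point :=
  let r := d.2 - d.1 in
  let turns := [:: turn_left r; r; - turn_left r; - r] in
  let i := find (fun w => linked d.2 (d.2 + w)) turns in
  (d.2, d.2 + nth (- r) turns i).

(* s is a portion of the outer boundary, walked from u to v. *)
Definition boundary_portion (u v : point) (s : seq (point * point)) : bool :=
  if s is d :: s' then
    [&& d.1 == u, (last d s').2 == v, fpath next_dart d s',
        uniq (d :: s') & all outer_dart (d :: s')]
  else false.

(* The vertices of G_1 met along s, other than a and b.  A face is listed once
   for each of its outer boundary edges on s: each of these is crossed by a
   separate edge of G^(k), as reflected by K(x,x) = 4. *)
Definition boundary_between (a b : faces) (s : seq (point * point)) :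
    seq faces :=
  [seq y <- pmap insub [seq right_cell d | d <- s] | y \notin [:: a; b]].

Definition Kmx : 'M[rat]_#|{: faces}| :=
  \matrix_(i, j) (if i == j then 4
                  else if face_adj (enum_val i) (enum_val j) then -1 else 0).
Definition green (x y : faces) : rat :=
  invmx Kmx (enum_rank x) (enum_rank y).

Section Superposition.
(* n = 2k - 1 terminals; f i is the edge crossed by the edge from T_i to t i. *)
Variables (n : nat) (f : 'I_n -> edges G).

Definition terminals (t : 'I_n -> faces) : Prop :=
  injective f /\
  forall i, outer_edge (val (f i)) && (val (f i) \in sides (val (t i))).

Definition terminal_free (s : seq (point * point)) : Prop :=
  forall i d, d \in s -> val (f i) != d /\ val (f i) != rev_dart d.

(* The vertices of G^(k): those of G_{1,T}, those of G_2, and the m_e. *)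
Definition gvert : finType := ((faces + 'I_n) + verts G + edges G)%type.
Definition in_G1T (x : faces + 'I_n) : gvert := inl (inl x).
Definition in_G1 (x : faces) : gvert := in_G1T (inl x).
Definition in_T (i : 'I_n) : gvert := in_G1T (inr i).
Definition in_G2 (p : verts G) : gvert := inl (inr p).
Definition in_mid (e : edges G) : gvert := inr e.

Definition gadj (x y : gvert) : bool :=
  match x, y with
  | inr e, inl (inr p) => (val p == (val e).1) || (val p == (val e).2)
  | inr e, inl (inl (inl c)) => val e \in sides (val c)
  | inr e, inl (inl (inr i)) => e == f i
  | inl (inl (inl c)), inl (inr p) => val p \in corners (val c)
  | inl (inl (inr i)), inl (inr p) =>
      (val p == (val (f i)).1) || (val p == (val (f i)).2)
  | _, _ => false
  end.

Definition gedges : {set {set gvert}} :=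
  [set [set xy.1; xy.2] | xy : gvert * gvert & gadj xy.1 xy.2].

Definition perfect_matching (M : {set {set gvert}}) : bool :=
  (M \subset gedges) && [forall x : gvert, #|[set e in M | x \in e]| == 1%N].

Definition impurities (M : {set {set gvert}}) : {set {set gvert}} :=
  [set e in M | [exists x, exists p, e == [set in_G1T x; in_G2 p]]].

Definition matchings_with_impurities (a b : faces) (u v : verts G) :
    {set {set {set gvert}}} :=
  [set M | perfect_matching M &&
           (impurities M == [set [set in_G1 a; in_G2 u]; [set in_G1 b; in_G2 v]])].

End Superposition.
End PlaneGraph.

(* Main.v *)
(** A perfect matching with impurities at (a, I1) and (b, I2) is a nonzero term
    of the determinant of a square matrix whose rows are the edges of G_2
    together with four rows pinning a, b, I1, I2, and whose columns are the
    faces, vertices and terminals; the entries are the incidence numbers of the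
    cellular (co)boundary maps.

    All nonzero terms have the same sign.  In the doubled lattice (vertex p at
    2p, face c at 2c + (1, 1), edge at the sum of its ends) matchings are domino
    tilings.  Ordering white points by (u, v) and black points by (u, - v), with
    u = x + y and v = x - y, the parity of the inversions of any tiling is a sum
    of terms attached to single dominoes, and around each elementary block of
    four points these terms alternate, as do the incidence numbers because the
    boundary of a boundary vanishes.  The symmetric difference of two tilings is
    the boundary mod 2 of a set of blocks, none of which meets a missing point,
    since every missing point is connected to infinity through missing points;
    so the signs agree block by block.

    The determinant is evaluated by multiplying with an integer matrix built
    from the face boundaries and from paths issued from I1 (the path to I2 being
    the terminal-free portion of the boundary).  It is unimodular because every
    closed integer chain is a sum of face boundaries; the product is block
    shaped with a block K, and its Schur complement is the 3 x 3 matrix up to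
    elementary row operations and signs. *)
Require Import Defs.
From HB Require Import structures.
From mathcomp Require Import all_boot all_order all_fingroup all_algebra finmap.
From mathcomp Require Import zify ring.

Set Implicit Arguments.
Unset Strict Implicit.
Unset Printing Implicit Defensive.

Import Order.TTheory GRing.Theory Num.Theory.
Local Open Scope ring_scope.

(** * Potentials of closed chains on the lattice *)

Definition in_box (H : int) (P : point) : bool :=
  (- H <= P.1 <= H) && (- H <= P.2 <= H).

Lemma eq_const_far (A : zmodType) (f : int -> A) (H : int) :
  (forall x, f x = f (x - 1)) -> (forall x, x < - H -> f x = 0) ->
  forall x, f x = 0.
Proof.
move=> fS f0 x; have fn (n : nat) : f x = f (x - n%:Z).
  elim: n => [|n ->]; first by rewrite subr0.
  by rewrite fS; congr f; lia.
by rewrite (fn (absz (x + H + 1))); apply: f0; lia.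
Qed.

(** Discrete Poincaré lemma. Here [zh P] and [zv P] are the flows from [P] to the right and upwards;
    a finitely supported flow without sources is the boundary of a finitely supported function of
    the squares, found by summing the vertical flow along each row. *)
Lemma plane_potential (A : zmodType) (zh zv : point -> A) (H : int) :
  (forall P, zh P + zv P = zh (P - ex) + zv (P - ey)) ->
  (forall P, ~~ in_box H P -> zh P = 0 /\ zv P = 0) ->
  exists g : point -> A,
    [/\ forall P, g (P - ex) - g P = zv P,
        forall P, g P - g (P - ey) = zh P &
        forall P, ~~ in_box H P -> g P = 0].
Proof.
move=> zdiv zbox.
(* [num x] is the number of columns from [- H] to [x], so [g P] is minus the sum of [zv] at [P] and
   to its left. *)
pose num (x : int) : nat := if x >= - H then absz (x + H + 1) else 0%N.
pose g (P : point) := - \sum_(k < num P.1) zv (- H + k%:Z, P.2).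
have gE P : g (P - ex) - g P = zv P.
  case: P => x y; rewrite /g /= opprK subr0.
  case: (lerP (- H) x) => hx; last first.
    rewrite /num !ifF; [|lia..].
    rewrite !big_ord0 oppr0 add0r; case: (zbox (x, y)); rewrite /in_box /=; [lia|done].
  have -> : num x = (num (x - 1)).+1 by rewrite /num; case: ifP; case: ifP; lia.
  rewrite big_ord_recr /= addKr; congr (zv (_, _)).
  rewrite /num; case: ifP; lia.
have far P : P.1 < - H -> g P = 0.
  by case: P => x y /= hx; rewrite /g /num /= ifF ?big_ord0 ?oppr0 //; lia.
(* By the divergence condition the defect of this equation is constant along each row, and far to
   the left it is 0. *)
have gv P : g P - g (P - ey) = zh P.
  case: P => x y.
  apply/eqP; rewrite -subr_eq0; apply/eqP; move: x.
  apply: (@eq_const_far _ _ H) => x; last first.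
    move=> hx; rewrite !far //=; last lia.
    rewrite subr0 sub0r (zbox _ _).1 ?oppr0 //; rewrite /in_box /=; lia.
  have h1 := gE (x, y); have h2 := gE ((x, y) - ey).
  have hd := zdiv (x, y).
  have E1 : g (x, y) = g ((x, y) - ex) - zv (x, y) by rewrite -h1 subKr.
  have E2 : g ((x, y) - ey) = g ((x, y) - ey - ex) - zv ((x, y) - ey).
    by rewrite -h2 subKr.
  have E3 : zh (x, y) = zh ((x, y) - ex) + zv ((x, y) - ey) - zv (x, y).
    by rewrite -hd addrK.
  have -> : (x - 1, y) = (x, y) - ex by congr (_, _); rewrite /= ?subr0.
  rewrite E1 E2 E3 (addrAC (x, y)).
  have -> : forall u v w c d : A,
      u - c - (v - d) - (w + d - c) = u - v - w.
    move=> u v w c d; have -> : w + d - c = w - (c - d) by rewrite opprB addrA.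
    have -> : u - c - (v - d) = u - v - (c - d).
      by rewrite !opprD !opprK addrACA.
    by rewrite [- (w - _)]opprB addrA subrK.
  by [].
exists g; split=> // -[x y] out.
case: (boolP (- H <= y <= H)) => [hy|hy]; last first.
  rewrite /g big1 ?oppr0 // => i _; apply: (zbox _ _).2.
  by rewrite /in_box /=; lia.
case: (ltP x (- H)) => hx; first exact: far.
move: y {hy} (erefl (in_box H (x, y))) out => y _.
(* To the right of the box [zh] vanishes, so [g] is constant on vertical lines and vanishes far
   below; above and below the box every summand of [g] is 0. *)
have gx0 : forall y, g (x, y) = 0 \/ in_box H (x, y).
  move=> y'; case: (boolP (in_box H (x, y'))) => h; first by right.
  left; have hx' : H < x \/ x <= H by lia.
  case: hx' => hx'; last first.
    rewrite /g big1 ?oppr0 // => i _; apply: (zbox _ _).2.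
    by move: h; rewrite /in_box /=; lia.
  move: y' {h}; apply: (@eq_const_far _ _ H) => y'.
    apply/eqP; rewrite -subr_eq0 -[X in _ == X]((zbox (x, y') _).1); last first.
      by rewrite /in_box /=; lia.
    by rewrite -gv; apply/eqP; congr (_ - g _); congr (_, _); rewrite /= subr0.
  move=> hy'; rewrite /g big1 ?oppr0 // => i _; apply: (zbox _ _).2.
  by rewrite /in_box /=; lia.
by case: (gx0 y) => // ->.
Qed.

(** * Signs of domino tilings *)

Lemma prod_lt0 (I : Type) (s : seq I) (P : pred I) (F : I -> int) :
  (forall i, P i -> F i != 0) ->
  (\prod_(i <- s | P i) F i != 0) &&
  ((\prod_(i <- s | P i) F i < 0) == \big[addb/false]_(i <- s | P i) (F i < 0)).
Proof.
move=> F0; elim: s => [|x s /andP[IH1 /eqP IH2]]; first by rewrite !big_nil.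
rewrite !big_cons; case: ifP => Px; last by rewrite IH1 IH2 eqxx.
rewrite mulf_neq0 ?F0 //= -IH2; apply/eqP.
move: (F0 x Px) IH1; set a := F x; set b := \prod_(_ <- _ | _) _ => a0 b0.
case: (ltrgt0P a) a0 => //= ha _; case: (ltrgt0P b) b0 => //= hb _.
- by rewrite ltNge mulr_ge0 ?ltW.
- by rewrite pmulr_rlt0.
- by rewrite nmulr_rlt0 // hb.
- by rewrite ltNge mulr_le0 ?ltW.
Qed.

(** Permuting the keys permutes the columns of a Vandermonde matrix, and the sign of its determinant
    is the parity of the number of pairs in the wrong order. *)
Lemma odd_perm_key n (k : 'I_n -> int) (s : 'S_n) : injective k ->
  odd_perm s = \big[addb/false]_(i < n) \big[addb/false]_(j < n | (i < j)%N)
                 ((k (s j) < k (s i)) (+) (k j < k i)).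
Proof.
move=> kinj; pose V (f : 'I_n -> int) := \det (Vandermonde n (\row_i f i)).
have VE f : V f = \prod_(i < n) \prod_(j < n | (i < j)%N) (f j - f i).
  rewrite /V det_Vandermonde; apply: eq_bigr => i _; apply: eq_bigr => j _.
  by rewrite !mxE.
have Vs : V (k \o s) = (-1) ^+ s * V k.
  rewrite /V mulrC -det_perm -det_mulmx.
  have -> : Vandermonde n (\row_i (k \o s) i) =
            col_perm s (Vandermonde n (\row_i k i)).
    by apply/matrixP => i j; rewrite !mxE.
  by rewrite col_permE det_mulmx det_mulmx !det_perm odd_permV.
have lt0 f : injective f -> (V f != 0) && ((V f < 0) ==
    \big[addb/false]_(i < n) \big[addb/false]_(j < n | (i < j)%N) (f j < f i)).
  move=> finj.
  have h (i : 'I_n) : true -> \prod_(j < n | (i < j)%N) (f j - f i) != 0.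
    move=> _; apply/prodf_neq0 => j ij; rewrite subr_eq0.
    by apply/eqP => /finj ji; rewrite ji ltnn in ij.
  have /andP[h1 /eqP h2] := prod_lt0 (index_enum 'I_n) h.
  rewrite VE h1 h2; apply/eqP; apply: eq_bigr => i _.
  have h' (j : 'I_n) : (i < j)%N -> f j - f i != 0.
    by move=> ij; rewrite subr_eq0; apply/eqP => /finj ji; rewrite ji ltnn in ij.
  have /andP[_ /eqP ->] := prod_lt0 (index_enum 'I_n) h'.
  by apply: eq_bigr => j _; rewrite subr_lt0.
have /andP[V0 /eqP Vk] := lt0 k kinj.
have /andP[_ /eqP Vks] := lt0 (k \o s) (inj_comp kinj perm_inj).
under eq_bigr => i _ do rewrite big_split /=.
rewrite big_split /= -Vk -Vks Vs.
case: (odd_perm s); rewrite /= ?expr1 ?expr0 ?mul1r ?addbb // mulN1r oppr_lt0.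
by case: ltrgt0P V0.
Qed.

Lemma odd_perm_rel n (r : rel 'I_n) (s : 'S_n) :
  irreflexive r -> transitive r -> (forall i j, i != j -> r i j || r j i) ->
  odd_perm s = \big[addb/false]_(i < n) \big[addb/false]_(j < n | (i < j)%N)
                 (r (s j) (s i) (+) r j i).
Proof.
(* Counting predecessors turns the strict total order [r] into integer keys. *)
move=> ri rt rtot; pose k (i : 'I_n) : int := #|[pred j | r j i]|%:Z.
have kE i j : (k i < k j) = r i j.
  have mono i' j' : r i' j' -> k i' < k j'.
    move=> rij; rewrite /k ltz_nat; apply: proper_card; apply/properP; split.
      by apply/subsetP => x; rewrite !inE => /rt; apply.
    by exists i'; rewrite inE ?ri.
  apply/idP/idP => [kij|]; last exact: mono.
  have ij : i != j by apply: contraTneq kij => ->; rewrite ltxx.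
  case/orP: (rtot i j ij) => // /mono kji.
  by have := lt_trans kij kji; rewrite ltxx.
have kinj : injective k.
  move=> i j kij; apply/eqP; apply: contraT => /rtot.
  by rewrite -!kE kij ltxx.
rewrite (odd_perm_key s kinj); apply: eq_bigr => i _; apply: eq_bigr => j _.
by rewrite !kE.
Qed.

Definition udiag (P : point) : int := P.1 + P.2.
Definition vdiag (P : point) : int := P.1 - P.2.
Definition white (P : point) : bool := odd (absz (udiag P)).
Definition unit_steps : seq point := [:: ex; - ex; ey; - ey].
Definition adjacent (P Q : point) : bool := Q - P \in unit_steps.
Definition upper (P Q : point) : point := if udiag P < udiag Q then Q else P.
(** All points of a line of constant [udiag] have one colour; [before] is the order in which
    [lt_white] or [lt_black], whichever fits that colour, reads the line. *)
Definition before (P Q : point) : bool :=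
  (udiag P == udiag Q) &&
  (if white Q then vdiag P < vdiag Q else vdiag Q < vdiag P).
(* Lines of constant udiag are read upwards in vdiag at white points and
   downwards at black ones, so two dominoes between the same lines are always
   inverted; this cancels the mutual positions of their upper points. *)
Definition lt_white (P Q : point) : bool :=
  (udiag P < udiag Q) || ((udiag P == udiag Q) && (vdiag P < vdiag Q)).
Definition lt_black (P Q : point) : bool :=
  (udiag P < udiag Q) || ((udiag P == udiag Q) && (vdiag Q < vdiag P)).

Lemma adjacentP (P Q : point) : adjacent P Q ->
  (udiag Q = udiag P + 1 \/ udiag Q = udiag P - 1) /\
  (vdiag Q = vdiag P + 1 \/ vdiag Q = vdiag P - 1).
Proof.
case: P Q => x y [x' y']; rewrite /adjacent !inE /udiag /vdiag /=.
by rewrite !xpair_eqE /=; case/or4P => /andP[/eqP ? /eqP ?]; split; lia.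
Qed.

Lemma diag_inj (P Q : point) :
  udiag P = udiag Q -> vdiag P = vdiag Q -> P = Q.
Proof.
by case: P Q => x y [x' y']; rewrite /udiag /vdiag /= => ? ?; congr (_, _); lia.
Qed.

Lemma diag_parity (P : point) :
  (exists m, udiag P = 2 * m + (white P)%:Z) /\
  (exists m, udiag P - vdiag P = 2 * m).
Proof.
split; last by exists P.2; rewrite /udiag /vdiag; lia.
rewrite /white; set u := udiag P.
case: (boolP (odd _)) => h.
  by exists ((u - 1) %/ 2)%Z; lia.
by exists (u %/ 2)%Z; lia.
Qed.

(** Dominoes without a common line come in the same order at both ends. With one common line, the
    order of their two points on it decides, one of them being the upper end of the lower domino.
    Over the same two lines there is always an inversion, and exactly one of the two upper ends is
    before the other. *)
Lemma pair_inversion (p q p' q' : point) :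
  white p -> white p' -> ~~ white q -> ~~ white q' ->
  adjacent p q -> adjacent p' q' -> p != p' -> q != q' ->
  lt_white p' p (+) lt_black q' q =
  (before p' (upper p q) (+) before q' (upper p q)) (+)
  (before p (upper p' q') (+) before q (upper p' q')).
Proof.
move=> wp wp' wq wq' /adjacentP[au av] /adjacentP[au' av'] pp' qq'.
have pp : ~ (udiag p = udiag p' /\ vdiag p = vdiag p').
  by case=> h1 h2; move: pp'; rewrite (diag_inj h1 h2) eqxx.
have qq : ~ (udiag q = udiag q' /\ vdiag q = vdiag q').
  by case=> h1 h2; move: qq'; rewrite (diag_inj h1 h2) eqxx.
have [[m1 e1] [n1 f1]] := diag_parity p.
have [[m2 e2] [n2 f2]] := diag_parity p'.
rewrite wp in e1; rewrite wp' in e2.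
rewrite /upper /before /lt_white /lt_black.
have -> : white (if udiag p < udiag q then q else p) = ~~ (udiag p < udiag q).
  by case: ifP; rewrite ?wp ?(negbTE wq).
have -> : white (if udiag p' < udiag q' then q' else p') = ~~ (udiag p' < udiag q').
  by case: ifP; rewrite ?wp' ?(negbTE wq').
have E (f : point -> int) (b : bool) P Q : f (if b then P else Q) = if b then f P else f Q.
  by case: b.
rewrite !E {E}.
move: (udiag p) (udiag q) (udiag p') (udiag q') (vdiag p) (vdiag q) (vdiag p') (vdiag q')
  au av au' av' pp qq e1 f1 e2 f2.
move=> u uq u' uq' v vq v' vq' au av au' av' pp qq e1 f1 e2 f2 {wp wp' wq wq' pp' qq'}.
case: au => au; case: au' => au'; subst uq uq';
case: av => av; case: av' => av'; subst vq vq'.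
all: repeat match goal with
  | |- context [Order.lt ?a ?b] => first
    [ rewrite (_ : (a < b) = true); [|lia] | rewrite (_ : (a < b) = false); [|lia]
    | case: (ltrP a b) => ? ]
  | |- context [?a == ?b] => first
    [ rewrite (_ : (a == b) = true); [|lia] | rewrite (_ : (a == b) = false); [|lia]
    | case: (eqVneq a b) => ? ]
  end; try done.
Qed.

Lemma addb_sum_pairs n (F : 'I_n -> 'I_n -> bool) : (forall i, F i i = false) ->
  \big[addb/false]_(i < n) \big[addb/false]_(j < n | (i < j)%N) (F i j (+) F j i)
  = \big[addb/false]_(i < n) \big[addb/false]_(j < n) F i j.
Proof.
move=> Fii; under eq_bigr => i _ do rewrite big_split /=.
rewrite big_split /= [X in _ (+) X](exchange_big_dep xpredT) //= -big_split /=.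
apply: eq_bigr => i _; rewrite [RHS](bigID (fun j : 'I_n => (i < j)%N)) /=.
congr (_ (+) _); rewrite [RHS](bigD1 i) ?ltnn //= Fii addFb.
by apply: eq_bigl => j; rewrite -leqNgt ltn_neqAle andbC.
Qed.

Definition position n (p q : 'I_n -> point) (c : point) : bool :=
  \big[addb/false]_(j < n) (before (p j) c (+) before (q j) c).

(** Summing [pair_inversion] over all pairs, each domino collects the points before its upper end.
    The covered points are the same for all tilings, so [position] does not depend on the
    permutation and the parity becomes a sum over single dominoes. *)
Lemma domino_sign n (p q : 'I_n -> point) (s t : 'S_n) :
  injective p -> injective q -> (forall i, white (p i)) ->
  (forall i, ~~ white (q i)) ->
  (forall i, adjacent (p i) (q (s i))) -> (forall i, adjacent (p i) (q (t i))) ->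
  odd_perm s (+) odd_perm t =
  \big[addb/false]_(i < n) (position p q (upper (p i) (q (s i))) (+)
                            position p q (upper (p i) (q (t i)))).
Proof.
move=> pinj qinj wp wq adjs adjt.
pose r i j := lt_black (q i) (q j).
have ri : irreflexive r by move=> i; rewrite /r /lt_black; lia.
have rt : transitive r by move=> i j k; rewrite /r /lt_black; lia.
have rtot i j : i != j -> r i j || r j i.
  move=> ij; rewrite /r /lt_black; apply: contraNT ij => h.
  by apply/eqP/qinj/diag_inj; lia.
rewrite !(odd_perm_rel _ ri rt rtot).
pose w i j := lt_white (p i) (p j).
pose inv (x : 'S_n) := \big[addb/false]_(i < n)
  \big[addb/false]_(j < n | (i < j)%N) (w j i (+) r (x j) (x i)).
suff invE (x : 'S_n) : (forall i, adjacent (p i) (q (x i))) ->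
    inv x = \big[addb/false]_(i < n) position p q (upper (p i) (q (x i))).
  rewrite big_split /= -!invE // /inv -!big_split /=.
  apply: eq_bigr => i _; rewrite -!big_split /=; apply: eq_bigr => j _.
  by case: (w _ _); case: (r _ _); case: (r _ _); case: (r _ _).
move=> adjx.
pose up i := upper (p i) (q (x i)).
pose F i j := before (p j) (up i) (+) before (q (x j)) (up i).
have Fii i : F i i = false.
  rewrite /F /up /upper /before; have [au _] := adjacentP (adjx i).
  by case: ifP => h; rewrite !ltxx !if_same !andbF ?addbF ?addFb;
    apply/negbTE/nandP; left; lia.
transitivity (\big[addb/false]_(i < n) \big[addb/false]_(j < n) F i j).
  rewrite -(addb_sum_pairs Fii); apply: eq_bigr => i _; apply: eq_bigr => j ij.
  apply: pair_inversion => //.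
    by apply/eqP => /pinj ji; rewrite ji ltnn in ij.
  by apply/eqP => /qinj/perm_inj ji; rewrite ji ltnn in ij.
apply: eq_bigr => i _; rewrite /F /position !big_split /=; congr (_ (+) _).
by rewrite [RHS](reindex_perm x).
Qed.

(** By parity of [vdiag] no point of the line lies strictly between [c] and [c']. Both are present,
    so the numbers of points before them differ by one. *)
Lemma position_step n (p q : 'I_n -> point) (c c' : point) :
  injective p -> injective q -> (forall i, white (p i)) ->
  (forall i, ~~ white (q i)) ->
  udiag c = udiag c' -> vdiag c' = vdiag c + 2 ->
  (exists i, c = p i /\ exists j, c' = p j) \/
  (exists i, c = q i /\ exists j, c' = q j) ->
  position p q c (+) position p q c' = true.
Proof.
move=> pinj qinj wp wq cu cv; rewrite /position -big_split /=.
have wcc' : white c = white c' by rewrite /white cu.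
have opp x d : white x != white d -> before x d = false.
  move=> wxd; apply/negbTE/nandP; left; apply: contraNneq wxd => h.
  by rewrite /white h.
have par x d : udiag x = udiag d -> vdiag x != vdiag d + 1.
  have [_ [m hm]] := diag_parity x; have [_ [m' hm']] := diag_parity d.
  by move: hm hm'; lia.
have same (f : 'I_n -> point) k0 k : injective f -> k != k0 ->
    ~ (udiag (f k) = udiag (f k0) /\ vdiag (f k) = vdiag (f k0)).
  by move=> finj kk [h1 h2]; move: kk; apply/negP/negPn/eqP/finj/diag_inj.
case=> -[i [ci [j cj]]].
- have wc : white c by rewrite ci.
  rewrite (bigD1 i) //= big1 => [|k ki]; rewrite !(opp (q _)) -?wcc' ?wc -?negb_eqb
    ?(negbTE (wq _)) ?addbF //= /before -?wcc' wc.
    by rewrite -ci; lia.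
  by have := same p i k pinj ki; have := par (p k) c; rewrite -ci; lia.
- have wc : white c = false by apply/negbTE; rewrite ci.
  rewrite (bigD1 j) //= big1 => [|k kj]; rewrite !(opp (p _)) -?wcc' ?wc ?wp
    ?addFb //= /before -?wcc' wc.
    by rewrite -cj; lia.
  by have := same q j k qinj kj; have := par (q k) c; rewrite -cj; lia.
Qed.

(** * Comparison of two tilings *)

(** The four unit blocks around [P], each named by its lower left point. *)
Definition touching (P : point) : seq point :=
  [:: P; P - ex; P - ey; P - ex - ey].

Ltac decide_eqs := repeat match goal with
  | |- context [?a == ?b] => first
    [ rewrite (_ : (a == b) = true); [|lia] | rewrite (_ : (a == b) = false); [|lia] ]
  end.

Lemma adjacent_cases (P Q : point) : adjacent P Q ->
  [\/ Q = P + ex, Q = P - ex, Q = P + ey | Q = P - ey].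
Proof.
rewrite /adjacent !inE !subr_eq ![_ + P]addrC.
by case/or4P => /eqP ->; [apply: Or41|apply: Or42|apply: Or43|apply: Or44].
Qed.

Lemma adjacent_sum (P Q : point) : adjacent P Q ->
  (Q == P + ex) (+) (Q == P - ex) (+) (Q == P + ey) (+) (Q == P - ey) = true.
Proof.
case/adjacent_cases=> ->; case: P => x y; by rewrite !xpair_eqE /=; decide_eqs.
Qed.

Lemma adjacent_sym (P Q : point) : adjacent P Q = adjacent Q P.
Proof.
rewrite /adjacent !inE; have h d : (P - Q == d) = (Q - P == - d).
  by rewrite -[P - Q]opprB eqr_oppLR.
by rewrite !h !opprK; do 4! case: (_ == _).
Qed.

Lemma bounding_box n (p : 'I_n -> point) : exists H, forall i, in_box H (p i).
Proof.
exists (\sum_i (`|(p i).1| + `|(p i).2|)) => i.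
rewrite (bigD1 i) //=; set S := \sum_(_ | _) _.
have : 0 <= S by apply: sumr_ge0 => j _; apply: addr_ge0.
by rewrite /in_box; move: (p i) => [x y] /=; lia.
Qed.

Lemma fset_bounding_box (T : choiceType) (K : {fset T}) (loc : T -> point) :
  exists H, forall x : K, in_box H (loc (val x)).
Proof.
have [H HH] := bounding_box (fun i : 'I_#|{: K}| => loc (val (enum_val i))).
by exists H => x; have := HH (enum_rank x); rewrite enum_rankK.
Qed.

Lemma touching_corners (k P : point) : (k \in touching P) = (P \in corners k).
Proof.
rewrite /touching /corners !inE ![k == _]eq_sym !subr_eq.
by rewrite (addrAC k).
Qed.

Section Kasteleyn.
Variables (n : nat) (p q : 'I_n -> point) (s t : 'S_n).

(** The two tilings agree at [P]. For a point covered by no domino this holds vacuously, so missing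
    points are idle. *)
Definition idle (P : point) : Prop :=
  forall i, p i = P \/ q (s i) = P \/ q (t i) = P -> s i = t i.

(* A corner k stands for the unit block whose lower left point is k; d ranges
   over the mod 2 sets of blocks which cannot separate idle points. *)
Definition outer_corner (k : point) : Prop :=
  forall d : point -> bool,
    (exists H, forall P, ~~ in_box H P -> d P = false) ->
    (forall P, idle P -> forall k', k' \in touching P -> d k' = d P) ->
    d k = false.

(** Kasteleyn's condition for a block with all four points present: if [w] marks negative entries,
    the four entries around the block have product of negative sign. *)
Definition full_block (w : 'I_n -> 'I_n -> bool) (k : point) : Prop :=
  exists i i' j j',
    w i j (+) w i j' (+) w i' j (+) w i' j' = true /\
    ([/\ p i = k, p i' = k + ex + ey, q j = k + ex & q j' = k + ey] \/
     [/\ q j = k, q j' = k + ex + ey, p i = k + ex & p i' = k + ey]).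

Definition domino (x : 'S_n) (P Q : point) : bool :=
  \big[addb/false]_i (((p i == P) && (q (x i) == Q)) (+)
                      ((p i == Q) && (q (x i) == P))).
Definition sym_diff (P Q : point) : bool := domino s P Q (+) domino t P Q.

Lemma sym_diffC P Q : sym_diff P Q = sym_diff Q P.
Proof.
by congr (_ (+) _); apply: eq_bigr => i _; rewrite addbC.
Qed.

(** The right-hand side does not mention [x], so the symmetric difference of two tilings has even
    degree at every point. *)
Lemma domino_degree (x : 'S_n) P : (forall i, adjacent (p i) (q (x i))) ->
  domino x P (P + ex) (+) domino x P (P - ex) (+)
  domino x P (P + ey) (+) domino x P (P - ey) =
  \big[addb/false]_i ((p i == P) (+) (q i == P)).
Proof.
move=> adjx; rewrite /domino -!big_split /= [RHS]big_split /=.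
rewrite [X in _ = _ (+) X](reindex_perm x) /= -big_split /=.
apply: eq_bigr => i _.
have h1 := adjacent_sum (adjx i).
have := adjx i; rewrite adjacent_sym => /adjacent_sum h2.
case: (p i =P P) => [e1|_]; case: (q (x i) =P P) => [e2|_].
- by rewrite e1 e2; do 4! case: (_ == _).
- rewrite e1 in h1 *; move: h1.
  by rewrite !andbF !andTb !addbF => ->.
- rewrite e2 in h2 *; move: h2.
  by rewrite !andbT !addFb => ->.
- by rewrite !andbF.
Qed.

Lemma sym_diff_degree P : (forall i, adjacent (p i) (q (s i))) ->
  (forall i, adjacent (p i) (q (t i))) ->
  sym_diff P (P + ex) (+) sym_diff P (P - ex) (+)
  sym_diff P (P + ey) (+) sym_diff P (P - ey) = false.
Proof.
move=> adjs adjt; have := domino_degree P adjs.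
rewrite -(domino_degree P adjt) /sym_diff.
move: (domino s _ _) (domino s _ _) (domino s _ _) (domino s _ _).
move: (domino t _ _) (domino t _ _) (domino t _ _) (domino t _ _).
by do 8! case.
Qed.

Lemma idle_sym_diff P Q : idle P -> sym_diff P Q = false.
Proof.
move=> iP; rewrite /sym_diff /domino -big_split big1 //= => i _.
case: (boolP [|| p i == P, q (s i) == P | q (t i) == P]) => [h|].
  rewrite (iP i) ?addbb //.
  by case/or3P: h => /eqP; [left|right; left|right; right].
by rewrite !negb_or => /and3P[/negbTE-> /negbTE-> /negbTE->]; rewrite !andbF.
Qed.

Hypotheses (pinj : injective p) (qinj : injective q).
Hypotheses (wp : forall i, white (p i)) (wq : forall i, ~~ white (q i)).
Hypotheses (adjs : forall i, adjacent (p i) (q (s i)))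
           (adjt : forall i, adjacent (p i) (q (t i))).

Lemma pq_neq i j : (p i == q j) = false.
Proof. by apply/eqP => h; have := wq j; rewrite -h wp. Qed.

Lemma sym_diffE i j : sym_diff (p i) (q j) = (s i == j) (+) (t i == j).
Proof.
rewrite /sym_diff /domino.
have E (x : 'S_n) : \big[addb/false]_k (((p k == p i) && (q (x k) == q j)) (+)
                      ((p k == q j) && (q (x k) == p i))) = (x i == j).
  rewrite (bigD1 i) //= big1 => [|k ki].
    by rewrite eqxx pq_neq addbF (inj_eq qinj) addbF.
  by rewrite pq_neq (inj_eq pinj) (negbTE ki).
by rewrite !E.
Qed.

(** The symmetric difference is a cycle mod 2, so [plane_potential] over the group [bool] makes it
    the boundary of a finite set [d] of blocks: a domino is in the difference when exactly one of
    its two adjacent blocks is in [d]. At an idle point no edge of the difference ends, so the four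
    blocks around it are all in [d] or all outside. *)
Lemma sym_diff_potential : exists d : point -> bool,
  [/\ exists H, forall P, ~~ in_box H P -> d P = false,
      forall P, idle P -> forall k', k' \in touching P -> d k' = d P &
      forall P Q, adjacent P Q -> sym_diff P Q =
        \big[addb/false]_(k <- touching P | Q \in corners k) d k].
Proof.
have [H1 hp] := bounding_box p; have [H2 hq] := bounding_box q.
pose H := Num.max H1 H2.
have hbox P Q : ~~ in_box H P -> sym_diff P Q = false.
  move=> out; apply: idle_sym_diff => i h; exfalso.
  have : in_box H P.
    have mon P' : in_box H1 P' \/ in_box H2 P' -> in_box H P'.
      by rewrite /in_box /H; case: (P') => x y /=; lia.
    by case: h => [<-|[<-|<-]]; apply: mon; [left|right..].
  by rewrite (negbTE out).
have [|P out|d [d1 d2 d3]] := @plane_potential bool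
    (fun P => sym_diff P (P + ex)) (fun P => sym_diff P (P + ey)) H.
- move=> P; rewrite !subrK (sym_diffC _ P) (sym_diffC (P - ey)).
  have := sym_diff_degree P adjs adjt.
  set a := sym_diff _ _; set b := sym_diff _ _; set c := sym_diff _ _.
  by set e := sym_diff _ _; case: a; case: b; case: c; case: e.
- by rewrite !hbox.
have D1 P : d (P - ex) (+) d P = sym_diff P (P + ey) by apply: d1.
have D2 P : d P (+) d (P - ey) = sym_diff P (P + ex) by apply: d2.
exists d; split; first by exists H.
  move=> P iP k'; have h1 := D1 P; have h2 := D2 P; have h3 := D2 (P - ex).
  rewrite subrK (sym_diffC _ P) in h3; rewrite !idle_sym_diff // in h1 h2 h3.
  move: h1 h2 h3; rewrite !inE => h1 h2 h3 /or4P[] /eqP -> //.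
  - by case: (d P) h1; case: (d _).
  - by case: (d P) h2; case: (d _).
  by case: (d P) h1; case: (d (P - ex)) h3 => //; case: (d _).
move=> P Q adjPQ; rewrite big_mkcond !big_cons big_nil /=.
have hQ := adjacent_cases adjPQ.
have [e1 e2 e3 e4] : [/\ sym_diff P (P + ex) = d P (+) d (P - ey),
  sym_diff P (P - ex) = d (P - ex) (+) d (P - ex - ey),
  sym_diff P (P + ey) = d (P - ex) (+) d P &
  sym_diff P (P - ey) = d (P - ex - ey) (+) d (P - ey)].
  rewrite D1 D2 (sym_diffC P (P - ex)) (sym_diffC P (P - ey)); split=> //.
    by have := D2 (P - ex); rewrite subrK => ->.
  by have := D1 (P - ey); rewrite subrK addrAC => ->.
clear -hQ e1 e2 e3 e4.
case: hQ => ->; rewrite ?e1 ?e2 ?e3 ?e4; case: P {e1 e2 e3 e4} => x y.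
all: rewrite !inE !xpair_eqE /=.
all: decide_eqs; rewrite /=.
all: by do 4! case: (d _).
Qed.

(** Add to [w] the local weight from [domino_sign]. The sum over the symmetric difference is then a
    sum over the blocks in [d]; such a block is full, and around a full block both weights sum to 1,
    hence together to 0. *)
Lemma kasteleyn_sign (w : 'I_n -> 'I_n -> bool) :
  (forall k, outer_corner k \/ full_block w k) ->
  odd_perm s (+) odd_perm t =
  \big[addb/false]_i (w i (s i) (+) w i (t i)).
Proof.
move=> blocks.
rewrite (domino_sign pinj qinj wp wq adjs adjt).
pose g i j := w i j (+) position p q (upper (p i) (q j)).
suff : \big[addb/false]_i (g i (s i) (+) g i (t i)) = false.
  rewrite /g; under eq_bigr => i _ do rewrite addbACA.
  rewrite big_split /=; set X := \big[addb/false]_i _; set Y := \big[addb/false]_i _.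
  by case: X; case: Y.
have [d [dH didle dE]] := sym_diff_potential.
(* A finite list of all blocks touching a white point, common to all [i], so that the sums over
   points and blocks can be exchanged. *)
pose box := undup (flatten [seq touching (p i) | i <- enum 'I_n]).
(* [G k i] is the total weight of the possible dominoes at [p i] that are sides of the block [k]. *)
pose G k i := \big[addb/false]_(j | adjacent (p i) (q j) && (q j \in corners k)) g i j.
have step i : g i (s i) (+) g i (t i) =
    \big[addb/false]_(k <- touching (p i)) (d k && G k i).
  transitivity (\big[addb/false]_(j | adjacent (p i) (q j))
                  (sym_diff (p i) (q j) && g i j)).
    have one (x : 'S_n) : adjacent (p i) (q (x i)) -> g i (x i) =
        \big[addb/false]_(j | adjacent (p i) (q j)) ((x i == j) && g i j).
      move=> ax; rewrite (bigD1 (x i)) //= eqxx big1 ?addbF // => j /andP[_ jx].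
      by rewrite eq_sym (negbTE jx).
    rewrite (one s) // (one t) // -big_split; apply: eq_bigr => j _.
    by rewrite sym_diffE andb_addl.
  under eq_bigr => j aj do rewrite (dE _ _ aj) big_distrl /=.
  rewrite (exchange_big_dep xpredT) //=; apply: eq_bigr => k _.
  by rewrite /G big_distrr.
under eq_bigr => i _ do rewrite step.
have boxE i F : \big[addb/false]_(k <- touching (p i)) F k =
    \big[addb/false]_(k <- box | k \in touching (p i)) F k.
  rewrite -[RHS]big_filter; apply: perm_big; apply: uniq_perm.
  - by case: (p i) => x y; rewrite /= !inE !xpair_eqE /=; decide_eqs.
  - by rewrite filter_uniq ?undup_uniq.
  move=> k; rewrite mem_filter mem_undup; case: (boolP (k \in _)) => //= kt.
  by apply/esym/flatten_mapP; exists i; rewrite ?mem_enum.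
under eq_bigr => i _ do rewrite boxE.
rewrite (exchange_big_dep xpredT) //= big1 // => k _.
rewrite -big_distrr /=.
case: (blocks k) => [ok|]; first by rewrite (ok d).
case=> i [i' [j [j' [wE pos]]]].
have [kp kq] : (forall h, (k \in touching (p h)) = (h == i) || (h == i')) /\
               (forall h, (q h \in corners k) = (h == j) || (h == j')).
  have qp h h' : (q h == p h') = false by rewrite eq_sym pq_neq.
  case: pos => -[e1 e2 e3 e4]; split=> h; rewrite ?touching_corners.
  - have -> : corners k = [:: p i; q j; q j'; p i'] by rewrite /corners e1 e2 e3 e4.
    by rewrite !inE !pq_neq !(inj_eq pinj).
  - have -> : corners k = [:: p i; q j; q j'; p i'] by rewrite /corners e1 e2 e3 e4.
    by rewrite !inE !qp !(inj_eq qinj) orbF.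
  - have -> : corners k = [:: q j; p i; p i'; q j'] by rewrite /corners e1 e2 e3 e4.
    by rewrite !inE !pq_neq !(inj_eq pinj) orbF.
  - have -> : corners k = [:: q j; p i; p i'; q j'] by rewrite /corners e1 e2 e3 e4.
    by rewrite !inE !qp !(inj_eq qinj).
have pair_big F (x x' : 'I_n) : x != x' ->
    \big[addb/false]_(h | (h == x) || (h == x')) F h = F x (+) F x'.
  move=> xx; rewrite (bigD1 x) ?eqxx //= (big_pred1 x') // => h.
  by have [->|hx] /= := eqVneq h x; rewrite ?(negbTE xx) ?andbT.
have stepP (P : point) : P + ex + ey != P /\ P + ex != P + ey.
  by case: P => x y; rewrite !xpair_eqE /=; decide_eqs.
have [ii jj] : i != i' /\ j != j'.
  have [h1 h2] := stepP k.
  case: pos => -[e1 e2 e3 e4]; split; apply/eqP => e.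
  - by rewrite -e2 -e e1 eqxx in h1.
  - by rewrite -e3 -e4 e eqxx in h2.
  - by rewrite -e3 -e4 e eqxx in h2.
  - by rewrite -e2 -e e1 eqxx in h1.
under eq_bigl => h do rewrite kp.
rewrite pair_big //.
have GE h : h \in [:: i; i'] -> G k h = g h j (+) g h j'.
  move=> hh; rewrite /G -(pair_big (g h)) //; apply: eq_bigl => l.
  rewrite kq andbC; case: (boolP (_ || _)) => // hl /=.
  have adjk (P : point) : [/\ adjacent P (P + ex), adjacent P (P + ey),
      adjacent (P + ex) (P + ex + ey) & adjacent (P + ey) (P + ex + ey)].
    have adjD X e : e \in unit_steps -> adjacent X (X + e).
      by rewrite /adjacent addrAC subrr add0r.
    by rewrite {2}(addrAC P); split; apply: adjD.
  have [a1 a2 a3 a4] := adjk k; have [b1 b2 b3 b4] := And4 a1 a2 a3 a4.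
  rewrite adjacent_sym in b1; rewrite adjacent_sym in b2.
  rewrite adjacent_sym in b3; rewrite adjacent_sym in b4.
  move: hh hl; rewrite !inE => /orP[] /eqP -> /orP[] /eqP ->;
    by case: pos => -[e1 e2 e3 e4]; rewrite ?e1 ?e2 ?e3 ?e4.
rewrite !GE ?inE ?eqxx ?orbT // /g.
(* Among the four upper ends the top corner of the block occurs twice and cancels; [k + ex] and
   [k + ey] occur once each and are neighbours on a line, so [position_step] applies. *)
suff : position p q (upper (p i) (q j)) (+) position p q (upper (p i) (q j')) (+)
    position p q (upper (p i') (q j)) (+) position p q (upper (p i') (q j')) = true.
  move: wE.
  set p1 := position _ _ _; set p2 := position _ _ _.
  set p3 := position _ _ _; set p4 := position _ _ _.
  move: p1 p2 p3 p4 (w i j) (w i j') (w i' j) (w i' j') (d k); clear.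
  by do 9! case.
have uE (P : point) : [/\ udiag (P + ex) = udiag P + 1, udiag (P + ey) = udiag P + 1,
    vdiag (P + ex) = vdiag P + 1 & vdiag (P + ey) = vdiag P - 1].
  by case: P => x y; rewrite /udiag /vdiag /=; split; lia.
have [u1 u2 v1 v2] := uE k; have [_ u3 _ _] := uE (k + ex).
have upE (P Q : point) : udiag Q = udiag P + 1 -> upper P Q = Q /\ upper Q P = Q.
  by move=> h; rewrite /upper h; split; [rewrite ifT|rewrite ifF] => //; lia.
case: pos => -[e1 e2 e3 e4]; rewrite e1 e2 e3 e4.
- have [-> _] := upE _ _ u1; have [-> _] := upE _ _ u2.
  have [|_ ->] := upE (k + ex) (k + ex + ey); first by rewrite u3.
  have [|_ ->] := upE (k + ey) (k + ex + ey); first by rewrite u3 u1 u2.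
  rewrite -addbA addbb addbF addbC; apply: position_step => //.
  + by rewrite u1 u2.
  + by rewrite v1 v2; lia.
  by right; exists j'; split=> //; exists j.
- have [_ ->] := upE _ _ u1; have [_ ->] := upE _ _ u2.
  have [|-> _] := upE (k + ex) (k + ex + ey); first by rewrite u3.
  have [|-> _] := upE (k + ey) (k + ex + ey); first by rewrite u3 u1 u2.
  have d1 : position p q (k + ey) (+) position p q (k + ex) = true.
    apply: position_step => //.
    + by rewrite u1 u2.
    + by rewrite v1 v2; lia.
    by left; exists i'; split=> //; exists i.
  move: d1; case: (position p q (k + ex)); case: (position p q (k + ey)) => //= _;
  by case: (position _ _ _).
Qed.

End Kasteleyn.

(** * The doubled lattice *)

Definition locV (v : point) : point := v + v.
Definition locF (c : point) : point := c + c + ex + ey.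
Definition locE (e : point * point) : point := e.1 + e.2.

Definition unit_edge (e : point * point) : bool :=
  (e.2 == e.1 + ex) || (e.2 == e.1 + ey).

(** The boundary maps of the cell complex: the coefficient of [e] in the counterclockwise boundary
    of the square [c], and, in [vert_sign], head minus tail of an edge. *)
Definition face_sign (c : point) (e : point * point) : int :=
  (e == (c, c + ex))%:R + (e == (c + ex, c + ex + ey))%:R
  - (e == (c, c + ey))%:R - (e == (c + ey, c + ey + ex))%:R.
Definition vert_sign (v : point) (e : point * point) : int :=
  (e.2 == v)%:R - (e.1 == v)%:R.

Ltac point_eq := apply/eqP; rewrite ?xpair_eqE /=; lia.

Lemma corner_touching (c p : point) : p \in corners c ->
  c + p \in touching (locF c) /\ c + p \in touching (locV p).
Proof.
rewrite !touching_corners /locF /locV !inE => /or4P[] /eqP ->; case: c => x y;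
  by rewrite !xpair_eqE /=; split; lia.
Qed.

Lemma side_cases (c : point) (e : point * point) : e \in sides c ->
  [\/ e = (c, c + ex), e = (c, c + ey), e = (c + ey, c + ey + ex) |
      e = (c + ex, c + ex + ey)].
Proof.
by rewrite !inE => /or4P[] /eqP ->; [apply: Or41|apply: Or42|apply: Or43|apply: Or44].
Qed.

Lemma side_touching (c : point) (e : point * point) : e \in sides c ->
  [/\ e.1 \in corners c, e.2 \in corners c, c + e.1 \in touching (locE e) &
      c + e.2 \in touching (locE e)].
Proof.
move=> /side_cases[] ->; rewrite !touching_corners /locE !inE /=; case: c => x y;
  by rewrite !xpair_eqE /=; split; lia.
Qed.

Lemma side_adjacent (c : point) (e : point * point) : e \in sides c ->
  adjacent (locE e) (locF c).
Proof.
move=> /side_cases[] ->; rewrite /adjacent /locE /locF !inE /=; case: c => x y;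
  by rewrite !xpair_eqE /=; lia.
Qed.

Lemma side_unit (c : point) (e : point * point) : e \in sides c -> unit_edge e.
Proof. by move=> /side_cases[] ->; rewrite /unit_edge eqxx ?orbT. Qed.

Lemma end_adjacent (v : point) (e : point * point) : unit_edge e ->
  v = e.1 \/ v = e.2 -> adjacent (locE e) (locV v).
Proof.
case: e => -[x y] e2; rewrite /unit_edge /=.
by case/orP=> /eqP-> [] ->; rewrite /adjacent !inE !xpair_eqE /=; lia.
Qed.

Lemma locF_inj : injective locF.
Proof. by move=> [x y] [x' y'] /eqP; rewrite xpair_eqE /= => h; point_eq. Qed.

Lemma locV_inj : injective locV.
Proof. by move=> [x y] [x' y'] /eqP; rewrite xpair_eqE /= => h; point_eq. Qed.

Lemma locVF v c : locV v <> locF c.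
Proof. by case: v c => x y [x' y'] /eqP; rewrite xpair_eqE /=; lia. Qed.

Lemma locE_inj e e' : unit_edge e -> unit_edge e' -> locE e = locE e' -> e = e'.
Proof.
case: e e' => -[x y] [x1 y1] [[x' y'] [x1' y1']].
rewrite /unit_edge !xpair_eqE /= => h h' /eqP; rewrite xpair_eqE /= => hh.
by congr (_, _, (_, _)); lia.
Qed.

Lemma white_locE e : unit_edge e -> white (locE e).
Proof.
case: e => -[x y] [x1 y1]; rewrite /unit_edge !xpair_eqE /white /udiag /=.
by lia.
Qed.

Lemma black_locV v : ~~ white (locV v).
Proof. by case: v => x y; rewrite /white /udiag /=; lia. Qed.

Lemma black_locF v : ~~ white (locF v).
Proof. by case: v => x y; rewrite /white /udiag /=; lia. Qed.

Lemma face_sign_side c e : (face_sign c e != 0) = (e \in sides c).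
Proof.
have [s|] := boolP (e \in sides c).
  by case/side_cases: s => ->; rewrite /face_sign; case: c => x y;
    rewrite !xpair_eqE /=; decide_eqs.
rewrite !inE !negb_or /face_sign => /and4P[/negbTE -> /negbTE -> /negbTE -> /negbTE ->].
by rewrite eqxx.
Qed.

Lemma vert_sign_end v e : unit_edge e ->
  (vert_sign v e != 0) = (v == e.1) || (v == e.2).
Proof.
move=> ue; rewrite /vert_sign (eq_sym v) (eq_sym v).
have : e.1 != e.2.
  by case: e ue => -[x y] [x' y']; rewrite /unit_edge !xpair_eqE /=; lia.
have [a|_] := eqVneq e.1 v; have [b|_] := eqVneq e.2 v; rewrite //.
by rewrite a b eqxx.
Qed.

Section Geometry.
Variable G : lattice_graph.
Hypothesis Gsquares : bounded_faces_are_squares G.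

Lemma edge_unit e : e \in edges G -> unit_edge e.
Proof. exact: edges_unit. Qed.

Lemma face_sides c : (c \in faces G) = all (fun e => e \in edges G) (sides c).
Proof.
rewrite !inE /= andb_idl // => /andP[/edges_ends/andP[]]. by [].
Qed.

Lemma face_side c e : c \in faces G -> e \in sides c -> e \in edges G.
Proof. by rewrite face_sides => /allP; apply. Qed.

Lemma face_corner c p : c \in faces G -> p \in corners c -> p \in verts G.
Proof.
move=> cF pc.
suff /hasP[e ec /orP] : has (fun e => (p == e.1) || (p == e.2)) (sides c).
  by have /edges_ends/andP[? ?] := face_side cF ec; case=> /eqP ->.
move: pc; rewrite !inE /= => /or4P[] /eqP ->; rewrite ?eqxx ?orbT //.
Qed.

(* A square which is not a face is glued to a neighbour across a missing side,
   so its face is not a unit square and cannot be bounded. *)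
Lemma outer_cell_far c (B : {fset point}) : c \notin faces G ->
  ~ (forall c', same_face G c c' -> c' \in B).
Proof.
move=> cF inB; have bounded : in_bounded_face G c by exists B.
have := cF; rewrite face_sides => /allPn[e ec eG].
have step c' : c' != c -> e \in sides c' -> False.
  move=> c'c ec'; suff : c' = c by move/eqP; rewrite (negbTE c'c).
  apply: Gsquares bounded _ _; exists [:: c']; split=> //=.
  by rewrite andbT /glued; apply/hasP; exists e; rewrite // ec'.
case/side_cases: ec => ee.
- apply: (step (c - ey)); first by case: c {cF inB bounded ee eG step} => x y; rewrite xpair_eqE /=; lia.
  by rewrite ee !inE !subrK eqxx !orbT.
- apply: (step (c - ex)); first by case: c {cF inB bounded ee eG step} => x y; rewrite xpair_eqE /=; lia.
  by rewrite ee !inE !subrK eqxx !orbT.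
- apply: (step (c + ey)); first by case: c {cF inB bounded ee eG step} => x y; rewrite xpair_eqE /=; lia.
  by rewrite ee !inE eqxx.
- apply: (step (c + ex)); first by case: c {cF inB bounded ee eG step} => x y; rewrite xpair_eqE /=; lia.
  by rewrite ee !inE eqxx !orbT.
Qed.

Definition box_cells (H : int) : {fset point} :=
  let s := [seq (i%:Z - `|H|) | i <- iota 0 (absz (2 * `|H| + 1))] in
  [fset P in [seq (x, y) | x <- s, y <- s]]%fset.

Lemma in_box_cells H P : in_box H P -> P \in box_cells H.
Proof.
case: P => x y; rewrite /in_box /= => h; rewrite !inE.
have inr z : - H <= z <= H ->
    z \in [seq (i%:Z - `|H|) | i <- iota 0 (absz (2 * `|H| + 1))].
  move=> hz; apply/mapP; exists (absz (z + `|H|)); last by lia.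
  by rewrite mem_iota; lia.
by apply/allpairsP; exists (x, y); split=> //=; apply: inr; lia.
Qed.

End Geometry.

Lemma face_signE c :
  [/\ face_sign c (c, c + ex) = 1, face_sign c (c, c + ey) = -1,
      face_sign c (c + ey, c + ey + ex) = -1 &
      face_sign c (c + ex, c + ex + ey) = 1].
Proof.
by case: c => x y; rewrite /face_sign !xpair_eqE /=; split; decide_eqs.
Qed.

Lemma face_sign_pm1 c e : e \in sides c ->
  face_sign c e = 1 \/ face_sign c e = -1.
Proof.
by have [? ? ? ?] := face_signE c; case/side_cases => ->; [left|right|right|left].
Qed.

Lemma vert_sign_pm1 v e : unit_edge e -> v = e.1 \/ v = e.2 ->
  vert_sign v e = 1 \/ vert_sign v e = -1.
Proof.
move=> ue; have ne : e.1 != e.2.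
  by case: e ue => -[x y] [x' y']; rewrite /unit_edge !xpair_eqE /=; lia.
rewrite /vert_sign; case=> ->; rewrite eqxx; [right|left].
  by rewrite eq_sym (negbTE ne).
by rewrite (negbTE ne).
Qed.

Lemma prod_pm1 (I : finType) (F : I -> int) : (forall i, F i = 1 \/ F i = -1) ->
  \prod_i F i = (-1) ^+ (\big[addb/false]_i (F i < 0)).
Proof.
move=> F1; apply: (big_rec2 (fun x (y : bool) => x = (-1) ^+ y)) => // i x y _ ->.
by rewrite signr_addb; case: (F1 i) => ->.
Qed.

(** * The incidence matrix and the common sign of its terms *)

Definition row_index (G : lattice_graph) := (edges G + 'I_4)%type.
Definition col_index (G : lattice_graph) := (faces G + (verts G + 'I_3))%type.

(* The rows [inr k] are adjacent to a, b, I1, I2 only: they play the role of the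
   impurities. *)
Definition incidence (G : lattice_graph) (f : 'I_3 -> edges G) (a b : faces G)
    (I1 I2 : verts G) (x : row_index G) (y : col_index G) : int :=
  match x, y with
  | inl e, inl c => face_sign (val c) (val e)
  | inl e, inr (inl v) => vert_sign (val v) (val e)
  | inl e, inr (inr i) => (e == f i)%:R
  | inr k, inl c => ((k == 0) && (c == a))%:R + ((k == 1) && (c == b))%:R
  | inr k, inr (inl v) => ((k == 2%:R) && (v == I1))%:R + ((k == 3%:R) && (v == I2))%:R
  | inr _, inr (inr _) => 0
  end.

Section Sign.
Variables (G : lattice_graph) (f : 'I_3 -> edges G) (a b : faces G) (I1 I2 : verts G).
Hypothesis Gsquares : bounded_faces_are_squares G.
Hypothesis finj : injective f.
Hypothesis fouter : forall i, outer_edge G (val (f i)).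
Hypotheses (I1_bd : outer_vertex G (val I1)) (I2_bd : outer_vertex G (val I2)).
Hypotheses (aI1 : val I1 \in corners (val a)) (bI2 : val I2 \in corners (val b)).
Hypotheses (ab : a != b) (I12 : I1 != I2).

Local Notation inc := (incidence f a b I1 I2).

(** Rows and columns with a forced partner carry the same number in [special_row] and [special_col]:
    0 to 3 for the pins of [a], [b], [I1], [I2], and [4 + i] for the edge [f i] and its terminal. *)
Definition special_row (x : row_index G) : option nat :=
  match x with
  | inr k => Some (nat_of_ord k)
  | inl e => if [pick i | f i == e] is Some i then Some (4 + i)%N else None
  end.
Definition special_col (y : col_index G) : option nat :=
  match y with
  | inl c => if c == a then Some 0%N else if c == b then Some 1%N else None
  | inr (inl v) => if v == I1 then Some 2%N else if v == I2 then Some 3%N else None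
  | inr (inr i) => Some (4 + i)%N
  end.

Lemma special_row_f i : special_row (inl (f i)) = Some (4 + i)%N.
Proof.
rewrite /=; case: pickP => [j /eqP/finj -> //|/(_ i)].
by rewrite eqxx.
Qed.

Lemma special_row_inj x x' m :
  special_row x = Some m -> special_row x' = Some m -> x = x'.
Proof.
have Pe e : special_row (inl e) = Some m -> exists2 i : 'I_3, e = f i & m = (4 + i)%N.
  by rewrite /=; case: pickP => // i /eqP <- [<-]; exists i.
case: x => [e /Pe[i -> h']|k [h']]; case: x' => [e' /Pe[i' -> h]|k' [h]].
- by congr (inl (f _)); apply: val_inj => /=; lia.
- by have := ltn_ord k'; lia.
- by have := ltn_ord k; lia.
- by congr inr; apply: val_inj; rewrite /= h h'.
Qed.

Lemma special_colP y m : special_col y = Some m ->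
  [\/ m = 0%N /\ y = inl a, m = 1%N /\ y = inl b,
      m = 2%N /\ y = inr (inl I1) | m = 3%N /\ y = inr (inl I2)]
  \/ exists i : 'I_3, m = (4 + i)%N /\ y = inr (inr i).
Proof.
case: y => [x|[v|i]] /=; last by case=> <-; right; exists i.
- have [->|_] := eqVneq x a; first by case=> <-; left; apply: Or41.
  by have [->|_] := eqVneq x b => // -[<-]; left; apply: Or42.
- have [->|_] := eqVneq v I1; first by case=> <-; left; apply: Or43.
  by have [->|_] := eqVneq v I2 => // -[<-]; left; apply: Or44.
Qed.

Lemma special_col_inj y y' m :
  special_col y = Some m -> special_col y' = Some m -> y = y'.
Proof.
by move=> /special_colP[[] [-> ->]|[i [-> ->]]] /special_colP[[] [h ->]|[i' [h ->]]];
  move: h => // h; do 2!congr inr; apply: val_inj => /=; clear -h; lia.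
Qed.

Lemma incidence_extra k y : inc (inr k) y != 0 -> special_col y = Some (nat_of_ord k).
Proof.
rewrite /incidence /special_col; case: y => [x|[v|//]].
  rewrite -[k == 0]val_eqE -[k == 1]val_eqE /=; have [->|_] := eqVneq x a.
    by rewrite (negbTE ab) andbT andbF; case: k => -[].
  by have [_|_] := eqVneq x b; rewrite !andbF ?andbT; case: k => -[|[]].
rewrite -[k == 2%:R]val_eqE -[k == 3%:R]val_eqE /=; have [->|_] := eqVneq v I1.
  by rewrite (negbTE I12) andbT andbF; case: k => -[|[|[]]].
by have [_|_] := eqVneq v I2; rewrite !andbF ?andbT; case: k => -[|[|[|[]]]].
Qed.

Lemma incidence_extra1 k y : inc (inr k) y != 0 -> inc (inr k) y = 1.
Proof.
have ind (m m' : 'I_4) (u u' : bool) : m != m' ->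
    ((k == m) && u)%:R + ((k == m') && u')%:R != 0 :> int ->
    ((k == m) && u)%:R + ((k == m') && u')%:R = 1 :> int.
  have [->|_] := eqVneq k m; first by move=> /negbTE -> /=; rewrite addr0; case: u.
  by move=> _; rewrite add0r; case: (_ && _).
by case: y => [x|[v|//]]; apply: ind.
Qed.

Lemma incidence_terminal x i : inc x (inr (inr i)) != 0 -> x = inl (f i).
Proof. by case: x => [e|//] /=; case: (e =P f i) => [->|]. Qed.

Variables (n : nat) (r : 'I_n -> row_index G) (c : 'I_n -> col_index G).
Hypotheses (rbij : bijective r) (cbij : bijective c).

Definition supported (s : 'S_n) : bool := [forall i, inc (r i) (c (s i)) != 0].

Lemma supportedP s i : supported s -> inc (r i) (c (s i)) != 0.
Proof. by move/forallP. Qed.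

(** An added row has its only nonzero entry in the column it pins, and a terminal column has its
    only nonzero entry in the row [f i]. A nonzero term must use these entries, which leaves only
    unnumbered columns for unnumbered rows. *)
Lemma supported_special s i : supported s ->
  special_row (r i) = special_col (c (s i)).
Proof.
move=> vs; have [r' r'K rK] := rbij; have [c' c'K cK] := cbij.
case rm: (special_row (r i)) => [m|].
  case rE: (r i) rm => [e|k]; last first.
    by case=> <-; apply/esym/incidence_extra; rewrite -rE supportedP.
  move=> em; have [j ej mj] : exists2 j : 'I_3, e = f j & m = (4 + j)%N.
    by move: em => /=; case: pickP => // j /eqP <- [<-]; exists j.
  pose i' := (s^-1)%g (c' (inr (inr j))).
  have : inc (r i') (c (s i')) != 0 by apply: supportedP.
  rewrite {2}/i' permKV cK => /incidence_terminal ri'.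
  have -> : i = i' by apply: (can_inj r'K); rewrite ri' rE ej.
  by rewrite /i' permKV cK mj.
case cm: (special_col _) => [m|//].
have [small|[j cj]] : (exists k : 'I_4, m = k) \/
    exists j : 'I_3, c (s i) = inr (inr j).
  case/special_colP: (cm) => [[] [-> _]|[j [_ ->]]]; last by right; exists j.
  - by left; exists 0.
  - by left; exists 1.
  - by left; exists 2%:R.
  - by left; exists 3%:R.
- have [k mk] := small; pose i' := r' (inr k).
  have := supportedP i' vs; rewrite {1}/i' rK => /incidence_extra; rewrite -mk.
  move/special_col_inj/(_ cm)/(can_inj c'K)/perm_inj => ii.
  by rewrite -ii /i' rK in rm.
- have := supportedP i vs; rewrite cj => /incidence_terminal ri.
  by rewrite ri special_row_f in rm.
Qed.

Section Locations.
Variable H : int.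
Hypothesis Hpos : 0 <= H.
Hypothesis HE : forall e : edges G, in_box H (locE (val e)).
Hypothesis HF : forall x : faces G, in_box H (locF (val x)).
Hypothesis HV : forall v : verts G, in_box H (locV (val v)).

(* Rows and columns whose partner is forced are sent to dominoes far away, which
   turns their true places into missing points. *)
Definition far_white (m : nat) : point := (2 * (H + m%:Z + 1), 1).
Definition far_black (m : nat) : point := (2 * (H + m%:Z + 1), 0).

Definition loc_row (x : row_index G) : point :=
  if special_row x is Some m then far_white m
  else if x is inl e then locE (val e) else 0.
Definition loc_col (y : col_index G) : point :=
  if special_col y is Some m then far_black m
  else match y with
       | inl x => locF (val x) | inr (inl v) => locV (val v) | _ => 0 end.

Lemma far_white_out m P : in_box H P -> P <> far_white m.
Proof. by case: P => x y; rewrite /in_box /= => h [] *; lia. Qed.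

Lemma far_black_out m P : in_box H P -> P <> far_black m.
Proof. by case: P => x y; rewrite /in_box /= => h [] *; lia. Qed.

Lemma far_white_inj : injective far_white.
Proof. by move=> m m' [] *; lia. Qed.

Lemma far_black_inj : injective far_black.
Proof. by move=> m m' [] *; lia. Qed.

Lemma loc_row_inj : injective loc_row.
Proof.
move=> x x'; rewrite /loc_row.
case sx: (special_row x) => [m|]; case sx': (special_row x') => [m'|].
- by move/far_white_inj => mm; apply: special_row_inj sx _; rewrite mm.
- case: x' sx' => // e _ h; exfalso; exact: (@far_white_out m (locE (val e))).
- case: x sx => // e _ h; exfalso; exact: (@far_white_out m' (locE (val e))).
case: x sx => // e _; case: x' sx' => // e' _ ee'; congr inl; apply: val_inj.
by apply: locE_inj ee'; apply: edge_unit; apply: valP.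
Qed.

Lemma loc_col_inj : injective loc_col.
Proof.
have inb y : special_col y = None -> in_box H (loc_col y).
  by rewrite /loc_col => sy; rewrite sy; case: y sy => [x|[v|i]] sy.
move=> y y' yy'; case sy: (special_col y) => [m|]; case sy': (special_col y') => [m'|].
- move: yy'; rewrite /loc_col sy sy' => /far_black_inj mm.
  by apply: special_col_inj sy _; rewrite mm.
- move: (inb _ sy'); rewrite -yy' /loc_col sy => h; exfalso; exact: (far_black_out h).
- move: (inb _ sy); rewrite yy' /loc_col sy' => h; exfalso; exact: (far_black_out h).
move: yy'; rewrite /loc_col sy sy'.
case: y sy => [x|[v|i]] // _; case: y' sy' => [x'|[v'|i']] // _.
- by move/locF_inj/val_inj ->.
- by move/esym/locVF.
- by move/locVF.
- by move/locV_inj/val_inj ->.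
Qed.

Lemma loc_row_white x : white (loc_row x).
Proof.
rewrite /loc_row; case sx: (special_row x) => [m|].
  by rewrite /white /udiag /=; lia.
by case: x sx => // e _; rewrite white_locE //; apply: edge_unit; apply: valP.
Qed.

Lemma loc_col_black y : ~~ white (loc_col y).
Proof.
rewrite /loc_col; case: (special_col y) => [m|]; first by rewrite /white /udiag /=; lia.
by case: y => [x|[v|i]] //; [apply: black_locF|apply: black_locV].
Qed.

Lemma incidence_cases e y : inc (inl e) y != 0 ->
  [\/ exists2 x, y = inl x & val e \in sides (val x),
      exists2 v, y = inr (inl v) & (val v = (val e).1 \/ val v = (val e).2) |
      exists2 i, y = inr (inr i) & e = f i].
Proof.
have ue : unit_edge (val e) by apply: edge_unit; apply: valP.
case: y => [x|[v|i]] /=.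
- by rewrite face_sign_side => h; apply: Or31; exists x.
- by rewrite vert_sign_end // => /orP h; apply: Or32; exists v => //; case: h => /eqP; [left|right].
- by case: (e =P f i) => // -> _; apply: Or33; exists i.
Qed.

Lemma supported_adjacent s i : supported s ->
  adjacent (loc_row (r i)) (loc_col (c (s i))).
Proof.
move=> vs; have sp := supported_special i vs; have := supportedP i vs.
rewrite /loc_row /loc_col sp; case sc: (special_col (c (s i))) => [m|].
  by move=> _; rewrite /adjacent !inE !xpair_eqE /=; lia.
case: (r i) sp => [e _|k]; last by rewrite sc.
case/incidence_cases => [[x -> ex]|[v -> ve]|[j cj _]].
- exact: side_adjacent.
- by apply: end_adjacent => //; apply: edge_unit; apply: valP.
by rewrite cj in sc.
Qed.


Lemma side_left_cell e : unit_edge e -> e \in sides (left_cell e).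
Proof.
case: e => -[x y] [x' y']; rewrite /unit_edge /left_cell /turn_left /=.
by case/orP => /eqP[-> ->]; rewrite !inE !xpair_eqE /=; lia.
Qed.

Lemma side_right_cell e : unit_edge e -> e \in sides (right_cell e).
Proof.
case: e => -[x y] [x' y']; rewrite /unit_edge /right_cell /left_cell /rev_dart /turn_left /=.
by case/orP => /eqP[-> ->]; rewrite !inE !xpair_eqE /=; lia.
Qed.

(** A block of the doubled lattice is a quarter of a lattice square: it holds the centre of a square
    [x] and one corner [v], and its lower left point is [x + v]. Halving [k] with rounding down
    gives [x], with rounding up gives [v]. *)
Lemma corner_decomposition (k : point) : exists x v, v \in corners x /\ k = x + v.
Proof.
case: k => x y; pose z : point := ((x %/ 2)%Z, (y %/ 2)%Z).
exists z, ((x, y) - z); split; last by rewrite addrC subrK.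
by rewrite !inE !xpair_eqE /=; lia.
Qed.

(** The other two points of the block are the midpoints of the sides of [x] that meet at [v]. Their
    contributions to the coefficient of [v] in the boundary of the boundary of [x] cancel, so the
    four signs alternate. *)
Lemma corner_sides (x v : point) : v \in corners x -> exists e e',
  [/\ e \in sides x, e' \in sides x, v = e.1 \/ v = e.2, v = e'.1 \/ v = e'.2 &
   (face_sign x e < 0) (+) (vert_sign v e < 0) (+)
   (face_sign x e' < 0) (+) (vert_sign v e' < 0) = true /\
   let k := x + v in
   [\/ [/\ locE e = k, locE e' = k + ex + ey, locF x = k + ex & locV v = k + ey],
       [/\ locE e = k, locE e' = k + ex + ey, locV v = k + ex & locF x = k + ey],
       [/\ locV v = k, locF x = k + ex + ey, locE e = k + ex & locE e' = k + ey] |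
       [/\ locF x = k, locV v = k + ex + ey, locE e = k + ex & locE e' = k + ey]]].
Proof.
have [s1 s2 s3 s4] := face_signE x.
have vs (P e : point) : e \in [:: ex; ey] ->
    vert_sign P (P, P + e) = -1 /\ vert_sign (P + e) (P, P + e) = 1.
  by rewrite !inE => /orP[] /eqP ->; case: P => z z'; rewrite /vert_sign !xpair_eqE /=;
    split; decide_eqs.
have vx P := vs P ex isT; have vy P := vs P ey isT.
rewrite !inE => /or4P[] /eqP ->.
- exists (x, x + ex), (x, x + ey); rewrite !inE !eqxx !orbT; split=> //; try by left.
  rewrite s1 s2 (vx x).1 (vy x).1; split=> //=; apply: Or43.
  by rewrite /locV /locE /locF /= !addrA; split.
- exists (x, x + ex), (x + ex, x + ex + ey); rewrite !inE !eqxx !orbT; split=> //; try by [left|right].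
  rewrite s1 s4 (vx x).2 (vy _).1; split=> //=; apply: Or42.
  by case: {s1 s2 s3 s4} x => z z'; rewrite /locV /locE /locF /=; split; point_eq.
- exists (x, x + ey), (x + ey, x + ey + ex); rewrite !inE !eqxx !orbT; split=> //; try by [left|right].
  rewrite s2 s3 (vx _).1 (vy _).2; split=> //=; apply: Or41.
  by case: {s1 s2 s3 s4} x => z z'; rewrite /locV /locE /locF /=; split; point_eq.
- exists (x + ex, x + ex + ey), (x + ey, x + ey + ex).
  rewrite !inE !eqxx !orbT; split=> //; [by right|by right; rewrite /= addrAC|].
  rewrite s4 s3 (addrAC x ex) (vx _).2 -(addrAC x ex) (vy _).2; split=> //=; apply: Or44.
  by case: {s1 s2 s3 s4} x => z z'; rewrite /locV /locE /locF /=; split; point_eq.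
Qed.

Section Blocks.
Variables s t : 'S_n.
Hypotheses (s_ok : supported s) (t_ok : supported t).
Let p i := loc_row (r i).
Let q i := loc_col (c i).

(** A row without a number, and its partners under [s] and [t], keep their true places, none of
    which is [P]. So a domino at [P] comes from a numbered row, whose partner is the same under [s]
    and [t]. *)
Lemma idle_absent P :
  (forall e, special_row (inl e) = None -> locE (val e) <> P) ->
  (forall x, special_col (inl x) = None -> locF (val x) <> P) ->
  (forall v, special_col (inr (inl v)) = None -> locV (val v) <> P) ->
  idle p q s t P.
Proof.
move=> hE hF hV i hi; have ss := supported_special i s_ok.
have st := supported_special i t_ok.
suff [m rm] : exists m, special_row (r i) = Some m.
  apply: (@perm_inj _ 1%g); rewrite !perm1; apply: (bij_inj cbij).
  by apply: (@special_col_inj _ _ m); rewrite -?ss -?st.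
case rm : (special_row (r i)) => [m|]; first by exists m.
exfalso; rewrite rm in ss st; rewrite /p /q /loc_row /loc_col rm -ss -st in hi.
have colP y : None = special_col y -> match y with
       | inl x => locF (val x) | inr (inl v) => locV (val v) | _ => 0 end <> P.
  by move=> /esym; case: y => [x /hF|[v /hV|//]].
case: hi => [|[]].
- by case: (r i) rm => // e /hE.
- exact: colP.
- exact: colP.
Qed.

Lemma idle_cell x : x \notin faces G \/ x = val a \/ x = val b ->
  idle p q s t (locF x).
Proof.
move=> hx; apply: idle_absent.
- move=> e _ h; have := black_locF x; rewrite -h white_locE //.
  by apply: edge_unit; apply: valP.
- move=> x' sx' /locF_inj xx'; case: hx; rewrite -xx'.
    by rewrite (valP x').
  by move: sx' => /=; case: eqP => // xa; case: eqP => // xb _ [] /val_inj.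
- by move=> v _ /locVF.
Qed.

Lemma idle_vert v : v \notin verts G \/ v = val I1 \/ v = val I2 ->
  idle p q s t (locV v).
Proof.
move=> hx; apply: idle_absent.
- move=> e _ h; have := black_locV v; rewrite -h white_locE //.
  by apply: edge_unit; apply: valP.
- by move=> x _ /esym/locVF.
- move=> x' sx' /locV_inj xx'; case: hx; rewrite -xx'.
    by rewrite (valP x').
  by move: sx' => /=; case: eqP => // xa; case: eqP => // xb _ [] /val_inj.
Qed.

Lemma idle_edge e : unit_edge e -> e \notin edges G \/ (exists i, e = val (f i)) ->
  idle p q s t (locE e).
Proof.
move=> ue hx; apply: idle_absent.
- move=> e' se' ee'; have {}ee' : val e' = e.
    by apply: locE_inj ee' => //; apply: edge_unit; apply: valP.
  case: hx; first by rewrite -ee' (valP e').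
  case=> i; rewrite -ee' => /val_inj ei.
  by rewrite ei special_row_f in se'.
- by move=> x _ h; have := black_locF (val x); rewrite h white_locE.
- by move=> x _ h; have := black_locV (val x); rewrite h white_locE.
Qed.

Section Potential.
Variable d : point -> bool.
Hypothesis dfar : exists H, forall P, ~~ in_box H P -> d P = false.
Hypothesis didle :
  forall P, idle p q s t P -> forall k, k \in touching P -> d k = d P.

Lemma idle_touching P Q k : idle p q s t P -> idle p q s t Q ->
  k \in touching P -> k \in touching Q -> d P = d Q.
Proof. by move=> iP iQ kP kQ; rewrite -(didle iP kP) (didle iQ kQ). Qed.

(** The centres of the two squares and the midpoint of the absent edge between them are idle, and
    consecutive ones share a block. *)
Lemma potential_glued x x' : x \notin faces G -> glued G x x' ->
  x' \notin faces G /\ d (locF x) = d (locF x').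
Proof.
move=> xF /hasP[e ex /andP[ex' eG]].
have x'F : x' \notin faces G by apply: contra eG => /face_side; apply.
split=> //; have ie : idle p q s t (locE e).
  by apply: idle_edge; [apply: side_unit ex|left].
have [e1 e2 e3 e4] := side_touching ex; have [f1 f2 f3 f4] := side_touching ex'.
have ix := idle_cell (or_introl xF); have ix' := idle_cell (or_introl x'F).
rewrite (idle_touching ix ie (corner_touching e1).1 e3).
by rewrite (idle_touching ix' ie (corner_touching f1).1 f3).
Qed.

(** If [d] held at [x] it would hold along every chain of glued squares, confining them to a box,
    whereas a square outside [faces] lies in an unbounded face. *)
Lemma potential_outer_cell x : x \notin faces G -> d (locF x) = false.
Proof.
move=> xF; have [B dB] := dfar; apply/negbTE/negP => dx.
apply: (outer_cell_far Gsquares (B := box_cells B) xF) => x' [pth [gp <-]].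
have {}gp : last x pth \notin faces G /\ d (locF (last x pth)).
  elim: pth x xF dx gp => //= y pth IH x xF dx /andP[gxy gp].
  by have [yF dxy] := potential_glued xF gxy; apply: IH; rewrite // -dxy.
have inB : in_box B (locF (last x pth)).
  by apply: contraT => /dB; rewrite gp.2.
apply: in_box_cells; move: inB; case: (last x pth) => z z'.
by rewrite /in_box /locF /=; clear; lia.
Qed.

Lemma potential_outer_cell_corner x k : x \notin faces G -> k \in touching (locF x) ->
  d k = false.
Proof.
by move=> xF kx; rewrite (didle (idle_cell (or_introl xF)) kx) potential_outer_cell.
Qed.

Lemma potential_outer_vertex v k : v = val I1 \/ v = val I2 ->
  k \in touching (locV v) -> d k = false.
Proof.
move=> vI kv; have iv := idle_vert (or_intror vI).
have /andP[_ /hasP[x xv xF]] : outer_vertex G v by case: vI => ->.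
have vx : v \in corners x.
  move: xv; rewrite !inE => /or4P[] /eqP ->; rewrite ?subrK ?eqxx ?orbT //.
  by rewrite (addrAC v) subrK addrAC subrK eqxx !orbT.
rewrite (didle iv kv) -(didle iv (corner_touching vx).2).
exact: potential_outer_cell_corner xF (corner_touching vx).1.
Qed.

(** The removed face has the removed vertex [I1] or [I2] as a corner, and that vertex is a corner of
    an outer square: this is how it is connected to infinity through missing points. *)
Lemma potential_impurity_cell x k : x = val a \/ x = val b ->
  k \in touching (locF x) -> d k = false.
Proof.
move=> xa kx; have ix := idle_cell (or_intror xa); rewrite (didle ix kx).
have [v vI vx] : exists2 v, v = val I1 \/ v = val I2 & v \in corners x.
  by case: xa => ->; [exists (val I1)|exists (val I2)]; auto.
rewrite -(didle ix (corner_touching vx).1).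
exact: potential_outer_vertex vI (corner_touching vx).2.
Qed.

(** The removed midpoint of [f i] shares a block with the centre of an outer square, since [f i] is
    an outer edge. *)
Lemma potential_terminal_edge i k : k \in touching (locE (val (f i))) -> d k = false.
Proof.
move=> ke; have ue : unit_edge (val (f i)) by apply: edge_unit; apply: valP.
have ie : idle p q s t (locE (val (f i))) by apply: idle_edge => //; right; exists i.
have /andP[_ out] := fouter i.
have [x ex xF] : exists2 x, val (f i) \in sides x & x \notin faces G.
  case/orP: out => xF; first by exists (left_cell (val (f i))) => //; apply: side_left_cell.
  by exists (right_cell (val (f i))) => //; apply: side_right_cell.
have [e1 _ e3 _] := side_touching ex.
rewrite (didle ie ke) -(didle ie e3).
exact: potential_outer_cell_corner xF (corner_touching e1).1.
Qed.

End Potential.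

Definition incidence_neg i j : bool := inc (r i) (c j) < 0.

(** If the square of the block is not a face, or one of the block's four points is removed, the
    potential vanishes there; otherwise all four are present and [corner_sides] gives the
    alternating signs. *)
Lemma outer_or_full k : outer_corner p q s t k \/ full_block p q incidence_neg k.
Proof.
have [x [v [vx ->]]] := corner_decomposition k.
have [kx kv] := corner_touching vx.
have [xF|xF] := boolP (x \in faces G); last first.
  by left=> d d1 d2; apply: potential_outer_cell_corner xF kx.
have [xa|xa] := boolP ((x == val a) || (x == val b)).
  left=> d d1 d2; apply: potential_impurity_cell kx => //.
  by case/orP: xa => /eqP; [left|right].
have vV := face_corner xF vx.
have [vI|vI] := boolP ((v == val I1) || (v == val I2)).
  left=> d d1 d2; apply: potential_outer_vertex kv => //.
  by case/orP: vI => /eqP; [left|right].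
have [e [e' [ex e'x ve ve' [signs pos]]]] := corner_sides vx.
have ke h : h \in sides x -> v = h.1 \/ v = h.2 -> x + v \in touching (locE h).
  by move=> /side_touching[_ _ t1 t2] [] ->.
have eG := face_side xF ex; have e'G := face_side xF e'x.
case sE: (special_row (inl [` eG]%fset)) => [m|].
  left=> d d1 d2; have [i fi] : exists i, f i = [` eG]%fset.
    by move: sE => /=; case: pickP => // i /eqP; exists i.
  by apply: (@potential_terminal_edge d d1 d2 i); rewrite fi; apply: ke.
case sE': (special_row (inl [` e'G]%fset)) => [m|].
  left=> d d1 d2; have [i fi] : exists i, f i = [` e'G]%fset.
    by move: sE' => /=; case: pickP => // i /eqP; exists i.
  by apply: (@potential_terminal_edge d d1 d2 i); rewrite fi; apply: ke.
right; have [r' r'K rK] := rbij; have [c' c'K cK] := cbij.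
pose i := r' (inl [` eG]%fset); pose i' := r' (inl [` e'G]%fset).
pose jx := c' (inl [` xF]%fset); pose jv := c' (inr (inl [` vV]%fset)).
have [pi pi'] : p i = locE e /\ p i' = locE e'.
  by rewrite /p !rK /loc_row sE sE'.
have [qx qv] : q jx = locF x /\ q jv = locV v.
  rewrite /q !cK /loc_col /= -!val_eqE /=.
  move: xa vI; rewrite !negb_or => /andP[/negbTE-> /negbTE->] /andP[/negbTE-> /negbTE->].
  by [].
have wE : incidence_neg i jx (+) incidence_neg i jv (+) incidence_neg i' jx (+)
    incidence_neg i' jv = true by rewrite /incidence_neg !rK !cK.
case: pos => -[].
- exists i, i', jx, jv; split=> //; left.
  by rewrite pi pi' qx qv.
- exists i, i', jv, jx; split.
    by move: wE; do 4! case: (incidence_neg _ _).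
  by left; rewrite pi pi' qx qv.
- exists i, i', jv, jx; split.
    by move: wE; do 4! case: (incidence_neg _ _).
  by right; rewrite pi pi' qx qv.
- exists i, i', jx, jv; split=> //; right.
  by rewrite pi pi' qx qv.
Qed.

Lemma supported_same_sign :
  (-1) ^+ s * \prod_i inc (r i) (c (s i)) = (-1) ^+ t * \prod_i inc (r i) (c (t i)).
Proof.
have pm1 (u : 'S_n) : supported u -> \prod_i inc (r i) (c (u i)) =
    (-1) ^+ (\big[addb/false]_i incidence_neg i (u i)).
  move=> u_ok; apply: prod_pm1 => i; have := supportedP i u_ok.
  case: (r i) => [e|k].
    have ue : unit_edge (val e) by apply: edge_unit; apply: valP.
    case/incidence_cases => [[x -> ex]|[v -> ve]|[j -> ->]] /=.
    - exact: face_sign_pm1.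
    - exact: vert_sign_pm1.
    - by rewrite eqxx; left.
  by move/incidence_extra1; left.
have pinj : injective p := inj_comp loc_row_inj (bij_inj rbij).
have qinj : injective q := inj_comp loc_col_inj (bij_inj cbij).
have := kasteleyn_sign pinj qinj (fun i => loc_row_white (r i))
  (fun j => loc_col_black (c j)) (fun i => supported_adjacent i s_ok)
  (fun i => supported_adjacent i t_ok) outer_or_full.
rewrite !pm1 // -!signr_addb big_split /=.
by case: (odd_perm s); case: (odd_perm t); do 2! case: (\big[addb/false]_i _).
Qed.

End Blocks.

End Locations.

End Sign.

(** The nonzero terms of the determinant are all equal to the same 1 or -1, so its absolute value
    counts them. *)
Lemma card_supported (G : lattice_graph) (f : 'I_3 -> edges G) (a b : faces G)
    (I1 I2 : verts G) (n : nat) (r : 'I_n -> row_index G) (c : 'I_n -> col_index G) :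
  bounded_faces_are_squares G -> injective f ->
  (forall i, outer_edge G (val (f i))) ->
  outer_vertex G (val I1) -> outer_vertex G (val I2) ->
  val I1 \in corners (val a) -> val I2 \in corners (val b) ->
  a != b -> I1 != I2 -> bijective r -> bijective c ->
  (#|[set s | supported f a b I1 I2 r c s]|)%:R =
  `|\det (\matrix_(i, j) incidence f a b I1 I2 (r i) (c j))|.
Proof.
move=> Gsq finj fout I1bd I2bd aI1 bI2 ab I12 rbij cbij.
pose inc := incidence f a b I1 I2.
pose term (s : 'S_n) := (-1) ^+ s * \prod_i inc (r i) (c (s i)).
have [HE hE] := fset_bounding_box (edges G) locE.
have [HF hF] := fset_bounding_box (faces G) locF.
have [HV hV] := fset_bounding_box (verts G) locV.
pose H := Num.max 0 (Num.max HE (Num.max HF HV)).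
have sub H' P : H' <= H -> in_box H' P -> in_box H P.
  by case: P => x y; rewrite /in_box /=; clear; lia.
have same s t : supported f a b I1 I2 r c s -> supported f a b I1 I2 r c t ->
    term s = term t.
  move=> vs vt; apply: (@supported_same_sign G f a b I1 I2 Gsq finj fout I1bd I2bd
    aI1 bI2 ab I12 n r c rbij cbij H) => //.
  - by rewrite /H; lia.
  - by move=> e; apply: sub (hE e); rewrite /H; lia.
  - by move=> e; apply: sub (hF e); rewrite /H; lia.
  - by move=> e; apply: sub (hV e); rewrite /H; lia.
have -> : \det (\matrix_(i, j) inc (r i) (c j)) =
    \sum_(s in [set s | supported f a b I1 I2 r c s]) term s.
  rewrite [RHS]big_mkcond; apply: eq_bigr => s _.
  under eq_bigr => i _ do rewrite mxE.
  rewrite inE; case: (boolP (supported _ _ _ _ _ _ _ s)) => // /forallPn[i].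
  by rewrite negbK => /eqP i0; rewrite (bigD1 i) //= /inc i0 mul0r mulr0.
have [->|/set0Pn[s0]] := eqVneq [set s | supported f a b I1 I2 r c s] set0.
  by rewrite cards0 big_set0 normr0.
rewrite inE => s0_ok.
rewrite (eq_bigr (fun=> term s0)) => [|s]; last by rewrite inE => /same; apply.
rewrite sumr_const normrMn.
suff -> : `|term s0| = 1 by [].
rewrite normrM normrX normrN1 expr1n mul1r normr_prod big1 // => i _.
have := supportedP i s0_ok; case: (r i) => [e|k].
  have ue : unit_edge (val e) by apply: edge_unit; apply: valP.
  case/incidence_cases => [[x -> ex]|[v -> ve]|[j -> ->]] /=.
  - by rewrite /inc /=; case: (face_sign_pm1 ex) => ->.
  - by rewrite /inc /=; case: (vert_sign_pm1 ue ve) => ->.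
  - by rewrite /inc /= eqxx.
by move/incidence_extra1; rewrite /inc => ->.
Qed.

(** * Homology of the plane graph *)

Definition extend (T : choiceType) (K : {fset T}) (A : zmodType) (z : K -> A) (x : T) : A :=
  if insub x is Some e then z e else 0.

Lemma extend_val (T : choiceType) (K : {fset T}) (A : zmodType) (z : K -> A) (e : K) :
  extend z (val e) = z e.
Proof. by rewrite /extend valK. Qed.

Lemma extend_out (T : choiceType) (K : {fset T}) (A : zmodType) (z : K -> A) x :
  x \notin K -> extend z x = 0.
Proof. by move=> xK; rewrite /extend insubN. Qed.

Lemma sum_extend (T : choiceType) (K : {fset T}) (A : pzRingType) (z : K -> A) x :
  \sum_(e : K) z e * (val e == x)%:R = extend z x.
Proof.
rewrite /extend; case: insubP => [e _ <-|xK].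
  rewrite (bigD1 e) //= eqxx mulr1 big1 ?addr0 // => e' ee'.
  by rewrite (inj_eq val_inj) (negbTE ee') mulr0.
rewrite big1 // => e _; case: eqP => [ex|_]; last by rewrite mulr0.
by rewrite -ex (valP e) in xK.
Qed.

Lemma extend_far (K : {fset point}) (A : zmodType) (z : K -> A) :
  exists H, forall P, ~~ in_box H P -> extend z P = 0.
Proof.
have [H hH] := fset_bounding_box K id.
exists H => P out; apply: extend_out; apply: contra out => PK.
exact: (hH [` PK]%fset).
Qed.

Definition right_of (P : point) : point * point := (P, P + ex).
Definition up_of (P : point) : point * point := (P, P + ey).

Lemma unit_edge_cases e : unit_edge e -> e = right_of e.1 \/ e = up_of e.1.
Proof.
by case: e => P Q; rewrite /unit_edge /= => /orP[] /eqP ->; [left|right].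
Qed.

Lemma right_ofE P Q : (right_of P == right_of Q) = (P == Q).
Proof. by rewrite xpair_eqE; case: (eqVneq P Q) => [->|] //=; rewrite eqxx. Qed.
Lemma up_ofE P Q : (up_of P == up_of Q) = (P == Q).
Proof. by rewrite xpair_eqE; case: (eqVneq P Q) => [->|] //=; rewrite eqxx. Qed.
Lemma right_up P Q : (right_of P == up_of Q) = false.
Proof. by case: P Q => x y [x' y']; rewrite !xpair_eqE /=; lia. Qed.
Lemma up_right P Q : (up_of P == right_of Q) = false.
Proof. by rewrite eq_sym right_up. Qed.

Lemma face_sign_right x P :
  face_sign x (right_of P) = (x == P)%:R - (x == P - ey)%:R.
Proof.
have -> : face_sign x (right_of P) =
    (right_of P == right_of x)%:R + (right_of P == up_of (x + ex))%:R
    - (right_of P == up_of x)%:R - (right_of P == right_of (x + ey))%:R by [].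
by rewrite !right_ofE !right_up addr0 subr0 (eq_sym P) (eq_sym P) eq_sym -subr_eq eq_sym.
Qed.

Lemma face_sign_up x P :
  face_sign x (up_of P) = (x == P - ex)%:R - (x == P)%:R.
Proof.
have -> : face_sign x (up_of P) =
    (up_of P == right_of x)%:R + (up_of P == up_of (x + ex))%:R
    - (up_of P == up_of x)%:R - (up_of P == right_of (x + ey))%:R by [].
rewrite !up_ofE !up_right add0r subr0 (eq_sym P x).
by rewrite -[P == x + ex]subr_eq (eq_sym _ x).
Qed.

Lemma vert_signE v e : unit_edge e ->
  vert_sign v e = (e == right_of (v - ex))%:R + (e == up_of (v - ey))%:R
                  - (e == right_of v)%:R - (e == up_of v)%:R.
Proof.
have sh P d : (P + d == v) = (P == v - d) by rewrite eq_sym -subr_eq eq_sym.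
case/unit_edge_cases => ->; rewrite /vert_sign /= sh.
  by rewrite !right_ofE !right_up addr0 subr0.
by rewrite !up_ofE !up_right add0r subr0.
Qed.

Section Homology.
Variable G : lattice_graph.

Lemma edge_unit_val (e : edges G) : unit_edge (val e).
Proof. by apply: edge_unit; apply: valP. Qed.

Lemma sum_vert_sign (z : edges G -> int) v :
  \sum_e z e * vert_sign v (val e) =
  extend z (right_of (v - ex)) + extend z (up_of (v - ey))
  - extend z (right_of v) - extend z (up_of v).
Proof.
under eq_bigr => e _ do rewrite (vert_signE v (edge_unit_val e)) !mulrBr mulrDr.
by rewrite !sumrB big_split /= !sum_extend.
Qed.

Lemma sum_face_sign (A : pzRingType) (g : faces G -> A) P :
  \sum_x g x * (face_sign (val x) (right_of P))%:~R = extend g P - extend g (P - ey) /\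
  \sum_x g x * (face_sign (val x) (up_of P))%:~R = extend g (P - ex) - extend g P.
Proof.
split.
  under eq_bigr => x _ do rewrite face_sign_right rmorphB /= mulrBr !mulrz_nat.
  by rewrite sumrB !sum_extend.
under eq_bigr => x _ do rewrite face_sign_up rmorphB /= mulrBr !mulrz_nat.
by rewrite sumrB !sum_extend.
Qed.

(** [phi] is constant on each chain of glued squares outside [faces], and such squares reach beyond
    every box, where [phi] is 0. *)
Lemma outer_cell_zero (A : zmodType) (phi : point -> A) x :
  bounded_faces_are_squares G ->
  (exists H, forall P, ~~ in_box H P -> phi P = 0) ->
  (forall y y', y \notin faces G -> glued G y y' -> phi y = phi y') ->
  x \notin faces G -> phi x = 0.
Proof.
move=> Gsq [B phiB] glue xF; apply/eqP/negPn/negP => phix.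
apply: (outer_cell_far Gsq (B := box_cells B) xF) => x' [pth [gp <-]].
have {}gp : phi (last x pth) != 0.
  elim: pth x xF phix gp => //= y pth IH x xF phix /andP[gxy gp].
  apply: IH gp; last by rewrite -(glue x).
  case/hasP: gxy => e _ /andP[es eG]; apply: contra eG => yF.
  exact: face_side yF es.
by apply: in_box_cells; apply: contraNT gp => /phiB ->.
Qed.

(** Extended by 0, a closed chain is a flow without sources on the whole lattice, hence has a
    potential [g]; it remains to see that [g] vanishes on all squares outside [faces]. *)
Lemma closed_chain (z : edges G -> int) : bounded_faces_are_squares G ->
  (forall u : verts G, \sum_e z e * vert_sign (val u) (val e) = 0) ->
  exists g : faces G -> int, forall e, z e = \sum_x g x * face_sign (val x) (val e).
Proof.
move=> Gsq zcl.
have [H hH] : exists H, forall P, ~~ in_box H P ->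
    extend z (right_of P) = 0 /\ extend z (up_of P) = 0.
  have [H hH] := fset_bounding_box (edges G) fst.
  by exists H => P out; split; apply: extend_out; apply: contra out => eG;
    exact: (hH [` eG]%fset).
have [|g [g1 g2 g3]] := @plane_potential _ (fun P => extend z (right_of P))
    (fun P => extend z (up_of P)) H _ hH.
  move=> P; have [PV|PV] := boolP (P \in verts G).
    have := zcl [` PV]%fset; rewrite sum_vert_sign /= => h.
    by apply/eqP; rewrite -subr_eq0 opprD -oppr_eq0; apply/eqP; rewrite -[RHS]h; ring.
  rewrite !extend_out //; apply: contra PV => /edges_ends /= /andP[];
    rewrite ?subrK //.
have gout x : x \notin faces G -> g x = 0.
  apply: (@outer_cell_zero _ g x Gsq); first by exists H.
  move=> y y' yF /hasP[e es /andP[es' eG]].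
  (* An absent edge carries no flow, so [g] agrees on its two sides. *)
  have zr P : right_of P \notin edges G -> g P = g (P - ey).
    by move=> h; apply/eqP; rewrite -subr_eq0 g2 extend_out.
  have zu P : up_of P \notin edges G -> g (P - ex) = g P.
    by move=> h; apply/eqP; rewrite -subr_eq0 g1 extend_out.
  have ge y0 : e \in sides y0 -> g y0 = g e.1.
    case/side_cases => ee; rewrite ee //=.
      by rewrite [RHS]zr ?addrK //; move: eG; rewrite ee.
    by rewrite -[RHS]zu ?addrK //; move: eG; rewrite ee.
  by rewrite (ge y) // (ge y').
exists (fun x => g (val x)) => e.
have ext P : extend (fun x : faces G => g (val x)) P = g P.
  rewrite /extend; case: insubP => [x _ -> //|/gout ->]; by [].
under eq_bigr => x _ do rewrite -[face_sign _ _]intz.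
have [s1 s2] := sum_face_sign (fun x : faces G => g (val x)) (val e).1.
case: (unit_edge_cases (edge_unit_val e)) => ee.
  by rewrite -[z e]extend_val ee s1 !ext g2 -ee.
by rewrite -[z e]extend_val ee s2 !ext g1 -ee.
Qed.

(** Extended by 0, [g] has the same value on both sides of each vertical edge: a present edge has
    coefficient 0, and next to an absent one neither square is a face. So [g] is constant along rows
    and 0 far away. *)
Lemma face_boundary_inj (A : pzRingType) (g : faces G -> A) :
  (forall e : edges G, \sum_x g x * (face_sign (val x) (val e))%:~R = 0) ->
  forall x, g x = 0.
Proof.
move=> g0 x; rewrite -extend_val; case: (val x) => i j; have [H hH] := extend_far g.
move: i; apply: (@eq_const_far _ _ H) => i; last first.
  by move=> hi; apply: hH; rewrite /in_box /=; clear -hi; lia.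
pose P : point := (i, j); have -> : (i - 1, j) = P - ex by congr (_, _); rewrite /= subr0.
have [eG|eG] := boolP (up_of P \in edges G).
  have [_ s2] := sum_face_sign g P; apply/esym/eqP; rewrite -subr_eq0 -s2.
  by apply/eqP; exact: (g0 [` eG]%fset).
have out y : up_of P \in sides y -> extend g y = 0.
  by move=> ys; apply: extend_out; apply: contra eG => /face_side; apply.
by rewrite !out //; rewrite !inE ?subrK ?eqxx ?orbT.
Qed.

End Homology.

(** * Chains carried by walks *)

Lemma cells_right_of P : left_cell (right_of P) = P /\ right_cell (right_of P) = P - ey.
Proof.
case: P => x y; rewrite /left_cell /right_cell /left_cell /rev_dart /turn_left /=.
by split; congr (_, _); rewrite /=; lia.
Qed.

Lemma cells_up_of P : left_cell (up_of P) = P - ex /\ right_cell (up_of P) = P.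
Proof.
case: P => x y; rewrite /left_cell /right_cell /left_cell /rev_dart /turn_left /=.
by split; congr (_, _); rewrite /=; lia.
Qed.

Lemma face_sign_cells x e : unit_edge e ->
  face_sign x e = (x == left_cell e)%:R - (x == right_cell e)%:R.
Proof.
case/unit_edge_cases => ->.
  by have [-> ->] := cells_right_of e.1; rewrite face_sign_right.
by have [-> ->] := cells_up_of e.1; rewrite face_sign_up.
Qed.

Lemma rev_dartK : involutive rev_dart.
Proof. by case. Qed.

Section Chains.
Variable G : lattice_graph.

Definition dart_chain (s : seq (point * point)) (e : edges G) : int :=
  \sum_(d <- s) ((val e == d)%:R - (val e == rev_dart d)%:R).

Lemma linked_dart d : linked G d.1 d.2 ->
  (d \in edges G /\ rev_dart d \notin edges G) \/
  (d \notin edges G /\ rev_dart d \in edges G).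
Proof.
have one e : e \in edges G -> rev_dart e \notin edges G.
  move=> /edge_unit ue; apply/negP => /edge_unit; move: ue.
  by case: e => -[x y] [x' y']; rewrite /unit_edge !xpair_eqE /=; clear; lia.
case: d => P Q /orP[] /= h; [left|right]; split=> //; first exact: one h.
by have := one _ h.
Qed.

Lemma sum_dart_chain (F : point * point -> int) (s : seq (point * point)) :
  \sum_(e : edges G) dart_chain s e * F (val e) =
  \sum_(d <- s) ((d \in edges G)%:R * F d - (rev_dart d \in edges G)%:R * F (rev_dart d)).
Proof.
under eq_bigr => e _ do rewrite /dart_chain big_distrl /=.
rewrite exchange_big; apply: eq_bigr => d _ /=.
have one d' : \sum_(e : edges G) F (val e) * (val e == d')%:R = (d' \in edges G)%:R * F d'.
  rewrite (sum_extend (fun e : edges G => F (val e))) /extend.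
  by case: insubP => [e -> <-|/negbTE ->]; rewrite ?mul1r ?mul0r.
by rewrite -!one -sumrB; apply: eq_bigr => e _; rewrite mulrC mulrBr.
Qed.

(** The square to the left of an outer dart is not a face, so only the right-hand square
    contributes. *)
Lemma dart_chain_face s x : all (outer_dart G) s -> x \in faces G ->
  \sum_(e : edges G) dart_chain s e * face_sign x (val e) =
  - \sum_(d <- s) (x == right_cell d)%:R.
Proof.
move=> /allP so xF; rewrite sum_dart_chain -sumrN; apply: eq_big_seq => d /so.
case/andP => ld lF; have xl : (x == left_cell d) = false.
  by apply: contraNF lF => /eqP <-.
case: (linked_dart ld) => -[h1 h2].
  by rewrite h1 (negbTE h2) mul1r mul0r subr0 face_sign_cells ?xl ?sub0r ?(edge_unit h1).
rewrite h2 (negbTE h1) mul1r mul0r sub0r face_sign_cells ?(edge_unit h2) //.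
have -> : right_cell (rev_dart d) = left_cell d by rewrite /right_cell rev_dartK.
by rewrite xl subr0.
Qed.

Lemma dart_chain_walk p s v : path (linked G) p s ->
  \sum_(e : edges G) dart_chain (pairmap pair p s) e * vert_sign v (val e) =
  (v == last p s)%:R - (v == p)%:R.
Proof.
rewrite sum_dart_chain; elim: s p => [|q s IH] p; first by rewrite big_nil subrr.
move=> /= /andP[pq ps]; rewrite big_cons IH //= {IH}.
have -> : ((p, q) \in edges G)%:R * vert_sign v (p, q) -
    (rev_dart (p, q) \in edges G)%:R * vert_sign v (rev_dart (p, q)) =
    (v == q)%:R - (v == p)%:R.
  rewrite /vert_sign /= (eq_sym v) (eq_sym v).
  by case: (@linked_dart (p, q) pq) => -[]; case: (_ \in _) => //= _;
    case: (_ \in _) => //= _; ring.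
ring.
Qed.

Lemma portion_walk u v s : boundary_portion G u v s ->
  [/\ s = pairmap pair u (unzip2 s), path (linked G) u (unzip2 s),
      last u (unzip2 s) = v & all (outer_dart G) s].
Proof.
case: s => //= d s /and5P[/eqP <- /eqP <- ds _ /andP[od os]].
have [h1 h2 h3] : [/\ s = pairmap pair d.2 (unzip2 s), path (linked G) d.2 (unzip2 s) &
    last d.2 (unzip2 s) = (last d s).2].
  elim: s d ds os {od} => //= d' s IH d /andP[/eqP dd' ds] /andP[od' os].
  have d1 : d'.1 = d.2 by rewrite -dd'.
  have [h1 h2 h3] := IH d' ds os; rewrite -h1 h2 h3 -d1 -surjective_pairing.
  by split=> //; rewrite andbT; case/andP: od'.
rewrite -h1 h2 h3 -surjective_pairing; split=> //; last by rewrite od.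
by rewrite andbT; case/andP: od.
Qed.

(** [X v] is the chain of some walk from [I1] to [v]; for [v = I2] it is the given portion [s],
    negated if walked from [I2]. The direction is recorded in [eps]. *)
Lemma path_chains (I1 I2 : verts G) (s : seq (point * point)) :
  connected_graph G ->
  boundary_portion G (val I1) (val I2) s \/ boundary_portion G (val I2) (val I1) s ->
  exists (X : verts G -> edges G -> int) (eps : bool),
  [/\ forall v u, \sum_e X v e * vert_sign (val u) (val e) = (u == v)%:R - (u == I1)%:R,
      forall x : faces G, \sum_e X I2 e * face_sign (val x) (val e) =
        (-1) ^+ eps * \sum_(d <- s) (val x == right_cell d)%:R &
      forall e, (forall d, d \in s -> val e != d /\ val e != rev_dart d) -> X I2 e = 0].
Proof.
move=> Gconn sp.
have [X0 X0E] : exists X : verts G -> edges G -> int, forall v u,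
    \sum_e X v e * vert_sign (val u) (val e) = (u == v)%:R - (u == I1)%:R.
  apply: (@fin_all_exists (verts G) (fun=> edges G -> int) (fun v Xv => forall u,
    \sum_e Xv e * vert_sign (val u) (val e) = (u == v)%:R - (u == I1)%:R)) => v.
  have [w [pw lw]] := Gconn _ _ (valP I1) (valP v).
  by exists (dart_chain (pairmap pair (val I1) w)) => u; rewrite dart_chain_walk // lw.
have s0 e : (forall d, d \in s -> val e != d /\ val e != rev_dart d) -> dart_chain s e = 0.
  move=> es; rewrite /dart_chain big_seq big1 // => d /es[/negbTE -> /negbTE ->].
  by rewrite subrr.
have [S [eps [S1 S2 S3]]] : exists (S : edges G -> int) (eps : bool),
  [/\ forall u : verts G, \sum_e S e * vert_sign (val u) (val e) = (u == I2)%:R - (u == I1)%:R,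
      forall x : faces G, \sum_e S e * face_sign (val x) (val e) =
        (-1) ^+ eps * \sum_(d <- s) (val x == right_cell d)%:R &
      forall e, (forall d, d \in s -> val e != d /\ val e != rev_dart d) -> S e = 0].
  case: sp => /portion_walk[sE sw sl so].
    exists (dart_chain s), true; split=> // [u|x].
      by rewrite sE dart_chain_walk // sl.
    by rewrite dart_chain_face ?mulN1r //; apply: valP.
  exists (fun e => - dart_chain s e), false; split=> [u|x|e /s0 ->].
  - under eq_bigr => e _ do rewrite mulNr.
    by rewrite sumrN sE dart_chain_walk // sl opprB.
  - under eq_bigr => e _ do rewrite mulNr.
    by rewrite sumrN dart_chain_face ?opprK ?mul1r //; apply: valP.
  - by rewrite oppr0.
exists (fun v => if v == I2 then S else X0 v), eps; split=> [v u|x|e].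
- by case: eqP => [->|_].
- by rewrite eqxx.
- by rewrite eqxx; apply: S3.
Qed.

End Chains.

(** * Evaluation of the determinant *)

Lemma shared_side (x x' : point) :
  has (fun e => e \in sides x') (sides x) = (x == x') || adjacent x x'.
Proof.
apply/hasP/orP => [[e ex ex']|[/eqP <-|]].
- apply/orP; move: ex ex'; case: x x' => i j [i' j'] /side_cases[] ->;
    move=> /side_cases[] /eqP; rewrite /adjacent !inE !xpair_eqE /= => h;
    clear -h; lia.
- by exists (x, x + ex); rewrite !inE eqxx.
- case/adjacent_cases=> ->.
  + by exists (x + ex, x + ex + ey); rewrite !inE ?eqxx ?orbT.
  + by exists (x, x + ey); rewrite !inE ?subrK ?eqxx ?orbT.
  + by exists (x + ey, x + ey + ex); rewrite !inE ?eqxx ?orbT.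
  + by exists (x, x + ex); rewrite !inE ?subrK ?eqxx ?orbT.
Qed.

(** * The matrix K as a Gram matrix *)

Section Gram.
Variable G : lattice_graph.

Lemma extend_face_sign (x : faces G) e :
  extend (fun e : edges G => face_sign (val x) (val e)) e = face_sign (val x) e.
Proof.
rewrite /extend; case: insubP => [e' _ <- //|eG].
apply/esym/eqP; rewrite -[_ == _]negbK face_sign_side; apply: contra eG.
exact/face_side/valP.
Qed.

Lemma face_vert_orthogonal (x : faces G) v :
  \sum_(e : edges G) face_sign (val x) (val e) * vert_sign v (val e) = 0.
Proof.
rewrite sum_vert_sign !extend_face_sign !face_sign_right !face_sign_up.
rewrite (addrAC v (- ey)); ring.
Qed.

(** A square has four sides, and two adjacent squares traverse their common side in opposite
    directions. *)
Lemma face_gram (x x' : faces G) :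
  (\sum_(e : edges G) face_sign (val x) (val e) * face_sign (val x') (val e))%:~R =
  Kmx G (enum_rank x) (enum_rank x').
Proof.
rewrite !mxE (inj_eq enum_rank_inj) !enum_rankK /face_adj shared_side.
pose z (e : edges G) := face_sign (val x) (val e).
have -> : \sum_(e : edges G) face_sign (val x) (val e) * face_sign (val x') (val e) =
    extend z (right_of (val x')) + extend z (up_of (val x' + ex))
    - extend z (up_of (val x')) - extend z (right_of (val x' + ey)).
  rewrite -!sum_extend -big_split -!sumrB /=; apply: eq_bigr => e _.
  by rewrite -/(z e) /face_sign mulrBr mulrBr mulrDr.
rewrite !extend_face_sign !face_sign_right !face_sign_up !addrK.
rewrite -(inj_eq val_inj); move: (val x) (val x') => {z x x'} x x'.
have [->|ne] := eqVneq x x'.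
  by rewrite /=; case: x' => i j; rewrite !xpair_eqE /=; decide_eqs.
have h d : (x == x' - d) = (x' - x == d) by rewrite eq_sym !subr_eq addrC.
have h' d : (x == x' + d) = (x' - x == - d) by rewrite -h opprK.
rewrite !h !h' /adjacent !inE.
have [->|_] := eqVneq (x' - x) ex; first by [].
have [->|_] := eqVneq (x' - x) (- ex); first by [].
have [->|_] := eqVneq (x' - x) ey; first by [].
by have [_|_] := eqVneq (x' - x) (- ey).
Qed.

(** K is positive definite: its quadratic form at [g] is the sum of squares of the boundary [dg],
    and the boundary map is injective on faces. *)
Lemma Kmx_unit : Kmx G \in unitmx.
Proof.
rewrite -row_free_unit; apply: inj_row_free => v vK.
pose g (x : faces G) := v 0 (enum_rank x).
pose dg (e : edges G) := \sum_x g x * (face_sign (val x) (val e))%:~R.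
have dg0 : \sum_e dg e ^+ 2 = 0.
  transitivity ((v *m Kmx G *m v^T) 0 0); last by rewrite vK mul0mx mxE.
  have reidx F : \sum_i F i = \sum_(x : faces G) F (enum_rank x) :> rat.
    exact: (reindex _ (onW_bij _ (@enum_rank_bij (faces G)))).
  rewrite mxE reidx; under [RHS]eq_bigr => x _ do rewrite mxE reidx.
  under [LHS]eq_bigr => e _ do rewrite expr2 {2}/dg big_distrr /=.
  rewrite exchange_big; apply: eq_bigr => x' _ /=.
  under [LHS]eq_bigr => e _ do rewrite /dg big_distrl /=.
  rewrite exchange_big /= big_distrl /=; apply: eq_bigr => x _ /=.
  rewrite [v^T _ _]mxE -face_gram rmorph_sum /= big_distrr /= big_distrl /=; apply: eq_bigr => e _.
  by rewrite rmorphM /g /=; ring.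
apply/rowP => i; rewrite mxE -[i]enum_valK; apply: (@face_boundary_inj G _ g) => e.
have := dg0; move/eqP; rewrite psumr_eq0 => [/allP/(_ e (mem_index_enum _))/=|e' _].
  by rewrite sqrf_eq0 => /eqP.
exact: sqr_ge0.
Qed.

End Gram.

Lemma det_schur (F : fieldType) m n (M : 'M[F]_(m + n)) : ulsubmx M \in unitmx ->
  \det M = \det (ulsubmx M) *
           \det (drsubmx M - dlsubmx M *m invmx (ulsubmx M) *m ursubmx M).
Proof.
move=> Ku; set K := ulsubmx M in Ku *; set D := _ - _.
have -> : M = block_mx 1%:M 0 (dlsubmx M *m invmx K) 1%:M *m
              block_mx K (ursubmx M) 0 D.
  rewrite mulmx_block !mul1mx !mul0mx ?mulmx0 ?addr0 ?add0r mulmxKV //.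
  by rewrite /D addrC subrK submxK.
by rewrite det_mulmx det_lblock det_ublock !det1 !mul1r.
Qed.

(** * The unimodular multiplier and Euler's formula *)

Section Theta.
Variables (G : lattice_graph) (I1 : verts G) (X : verts G -> edges G -> int).
Hypothesis Gsquares : bounded_faces_are_squares G.
Hypothesis X_boundary : forall v u,
  \sum_e X v e * vert_sign (val u) (val e) = (u == v)%:R - (u == I1)%:R.

(** The pins of [a], [I2], [b], in the order of the rows of the final 3 by 3 matrix; the pin of [I2]
    gives rise to the row of the boundary vertices between [a] and [b]. *)
Definition extra_row (i : 'I_3) : 'I_4 := nth 0 [:: 0; 3%:R; 1] i.

(* Columns: face boundaries; paths from I1 to v, completed by the row pinning I1
   so that v = I1 is not lost; unit vectors of the three other added rows. *)
Definition theta (x : row_index G) (y : col_index G) : int :=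
  match x, y with
  | inl e, inl c => face_sign (val c) (val e)
  | inl e, inr (inl v) => X v e
  | inr k, inr (inl _) => (k == 2%:R)%:R
  | inr k, inr (inr i) => (k == extra_row i)%:R
  | _, _ => 0
  end.

Lemma sum_col (R : nmodType) (F : col_index G -> R) :
  \sum_y F y = \sum_c F (inl c) + (\sum_v F (inr (inl v)) + \sum_i F (inr (inr i))).
Proof. by rewrite big_sumType /= [X in _ + X]big_sumType. Qed.

Lemma sum_row (R : nmodType) (F : row_index G -> R) :
  \sum_x F x = \sum_e F (inl e) + \sum_k F (inr k).
Proof. by rewrite big_sumType. Qed.

Lemma sum_delta (T : finType) (R : pzRingType) (x : T) (F : T -> R) :
  \sum_y F y * (y == x)%:R = F x.
Proof.
rewrite (bigD1 x) //= eqxx mulr1 big1 ?addr0 // => y yx.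
by rewrite (negbTE yx) mulr0.
Qed.

(** Every unit vector is an integer combination of the columns, because a closed integer chain is
    one of face boundaries. This provides an integer right inverse. *)
Lemma theta_surj (x : row_index G) : exists psi : col_index G -> int,
  forall x', \sum_y theta x' y * psi y = (x' == x)%:R.
Proof.
case: x => [e0|k].
  have /andP[V1 V2] := edges_ends (valP e0).
  pose v1 : verts G := [` V1]%fset; pose v2 : verts G := [` V2]%fset.
  (* The edge minus the path to its head plus the path to its tail is closed; the two paths cancel
     in the row pinning [I1]. *)
  pose z e := (e == e0)%:R - X v2 e + X v1 e.
  have [u|g gE] := closed_chain (z := z) Gsquares.
    transitivity (\sum_e vert_sign (val u) (val e) * (e == e0)%:R
      - \sum_e X v2 e * vert_sign (val u) (val e)
      + \sum_e X v1 e * vert_sign (val u) (val e)).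
      by rewrite -sumrB -big_split; apply: eq_bigr => e _ /=; rewrite /z; ring.
    rewrite sum_delta !X_boundary /vert_sign -!(inj_eq val_inj) /=.
    rewrite (eq_sym (val u) (val e0).1) (eq_sym (val u) (val e0).2); ring.
  exists (fun y => match y with
    | inl c => g c | inr (inl v) => (v == v2)%:R - (v == v1)%:R | _ => 0 end).
  move=> x'; rewrite sum_col [X in _ + (_ + X)]big1 ?addr0 => [|i _]; last by rewrite mulr0.
  under [X in _ + X]eq_bigr => v _ do rewrite mulrBr.
  rewrite sumrB !sum_delta; case: x' => [e|k] /=.
    under eq_bigr => c _ do rewrite mulrC.
    by rewrite -gE /z (inj_eq inl_inj); ring.
  by rewrite subrr addr0 big1 // => c _; rewrite mul0r.
have unit_col (i : 'I_3) : k = extra_row i -> exists psi : col_index G -> int,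
    forall x', \sum_y theta x' y * psi y = (x' == inr k)%:R.
  move=> ki; exists (fun y => (y == inr (inr i))%:R) => x'.
  by rewrite sum_delta ki; case: x' => [e|k'].
have [k2|k2] := eqVneq k 2%:R; last first.
  have : k = extra_row 0 \/ k = extra_row 1 \/ k = extra_row 2%:R.
    case: k k2 {unit_col} => -[|[|[|[|//]]]] kk //= _.
    - by left; apply: val_inj.
    - by right; right; apply: val_inj.
    - by right; left; apply: val_inj.
  by case=> [|[]]; apply: unit_col.
(* The path from [I1] to [I1] is closed; removing it by face boundaries leaves the unit vector of
   the row pinning [I1]. *)
have [u|g gE] := closed_chain (z := X I1) Gsquares.
  by rewrite X_boundary subrr.
exists (fun y => match y with
  | inl c => - g c | inr (inl v) => (v == I1)%:R | _ => 0 end) => x'.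
rewrite sum_col [X in _ + (_ + X)]big1 ?addr0 => [|i _]; last by rewrite mulr0.
rewrite sum_delta; case: x' => [e|k'] /=.
  by rewrite gE -big_split /= big1 // => c _; rewrite mulrN mulrC addNr.
by rewrite big1 ?add0r ?k2 // => c _; rewrite mul0r.
Qed.

(** The added rows kill the last three coefficients and the sum of the vertex coefficients. Taking
    boundaries kills the face part and isolates each vertex coefficient; the face boundaries that
    remain are independent. *)
Lemma theta_inj (v : col_index G -> rat) :
  (forall x, \sum_y (theta x y)%:~R * v y = 0) -> forall y, v y = 0.
Proof.
move=> v0.
have vT i : v (inr (inr i)) = 0.
  have := v0 (inr (extra_row i)); rewrite sum_col /= big1 ?add0r => [|j _]; last first.
    by rewrite mul0r.
  rewrite big1 ?add0r => [|j _]; last first.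
    by case: i => -[|[|[|//]]] ?; rewrite /= mul0r.
  rewrite (eq_bigr (fun j => v (inr (inr j)) * (j == i)%:R)) ?sum_delta // => j _.
  by rewrite mulrC; case: j i => -[|[|[|//]]] ? [[|[|[|//]]] ?].
have sumV : \sum_u v (inr (inl u)) = 0.
  have := v0 (inr 2%:R); rewrite sum_col /= big1 ?add0r => [|j _]; last by rewrite mul0r.
  rewrite [X in _ + X]big1 ?addr0 => [|j _]; last by rewrite vT mulr0.
  by under eq_bigr => u _ do rewrite mul1r.
have rowe e : \sum_c (face_sign (val c) (val e))%:~R * v (inl c) +
    \sum_u (X u e)%:~R * v (inr (inl u)) = 0.
  have := v0 (inl e); rewrite sum_col /= [X in _ + (_ + X)]big1 ?addr0 //.
  by move=> j _; rewrite mul0r.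
have vV u : v (inr (inl u)) = 0.
  have : \sum_e (\sum_c (face_sign (val c) (val e))%:~R * v (inl c) +
    \sum_u (X u e)%:~R * v (inr (inl u))) * (vert_sign (val u) (val e))%:~R = 0.
    by rewrite big1 // => e _; rewrite rowe mul0r.
  under eq_bigr => e _ do rewrite mulrDl !big_distrl /=.
  rewrite big_split /= exchange_big big1 ?add0r => [|c _]; last first.
    rewrite /= -[RHS](mulr0 (v (inl c))) -[X in _ = _ * X](rmorph0 (intr : int -> rat)).
    rewrite -(face_vert_orthogonal c (val u)) rmorph_sum /= big_distrr /=.
    by apply: eq_bigr => e _; rewrite rmorphM /=; ring.
  rewrite exchange_big /= => <-.
  rewrite (eq_bigr (fun w => v (inr (inl w)) * (w == u)%:R -
    v (inr (inl w)) * (u == I1)%:R)) => [|w _]; last first.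
    transitivity (v (inr (inl w)) * (\sum_e X w e * vert_sign (val u) (val e))%:~R).
      rewrite rmorph_sum /= big_distrr /=; apply: eq_bigr => e _.
      by rewrite rmorphM /=; ring.
    by rewrite X_boundary rmorphB /= !mulrz_nat mulrBr (eq_sym u w).
  by rewrite sumrB sum_delta -big_distrl /= sumV mul0r subr0.
case=> [c|[u|i]] //; apply: (@face_boundary_inj G _ (fun c => v (inl c))) => e.
rewrite -[RHS](rowe e) [X in _ + X]big1 ?addr0 => [|u _]; last by rewrite vV mulr0.
by apply: eq_bigr => c' _; rewrite mulrC.
Qed.

(** Euler's formula, V - E + F = 1, in the form E + 4 = F + V + 3: an integer right inverse bounds
    the number of rows, and independence of the columns bounds theirs. *)
Lemma card_index : #|{: row_index G}| = #|{: col_index G}|.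
Proof.
apply/eqP; rewrite eqn_leq; apply/andP; split.
  have [psi psiE] := fin_all_exists theta_surj.
  apply: (@mulmx1_min int _ _ (\matrix_(i, j) theta (enum_val i) (enum_val j))
    (\matrix_(j, i) psi (enum_val i) (enum_val j))).
  apply/matrixP => i j; rewrite !mxE.
  under eq_bigr => k _ do rewrite !mxE.
  rewrite -(reindex _ (onW_bij _ (@enum_val_bij {: col_index G})) (P := xpredT)
    (F := fun y => theta (enum_val i) y * psi (enum_val j) y)) /=.
  by rewrite psiE (inj_eq enum_val_inj).
pose T : 'M[rat]_(#|{: col_index G}|, #|{: row_index G}|) :=
  \matrix_(j, i) (theta (enum_val i) (enum_val j))%:~R.
suff : row_free T by rewrite -row_leq_rank => /leq_trans; apply; apply: rank_leq_col.
apply: inj_row_free => v vT; apply/rowP => j; rewrite mxE -[j]enum_valK.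
apply: (theta_inj (v := fun y => v 0 (enum_rank y))) => x.
have /rowP/(_ (enum_rank x)) := vT; rewrite !mxE => vTx.
rewrite -[RHS]vTx (reindex _ (onW_bij _ (@enum_val_bij {: col_index G}))) /=.
by apply: eq_bigr => k _; rewrite mxE enum_rankK enum_valK mulrC.
Qed.

End Theta.

(** An outer edge borders only one face, here [t]. *)
Lemma terminal_sign (G : lattice_graph) (e : edges G) (t x : faces G) :
  outer_edge G (val e) -> val e \in sides (val t) ->
  face_sign (val x) (val e) = face_sign (val t) (val e) * (x == t)%:R.
Proof.
move=> /andP[eG out] et; have ue := edge_unit eG.
have : face_sign (val t) (val e) != 0 by rewrite face_sign_side.
rewrite !(face_sign_cells _ ue) -(inj_eq val_inj).
have far y : y \notin faces G -> forall z : faces G, (val z == y) = false.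
  by move=> yF z; apply: contraNF yF => /eqP <-; apply: valP.
case/orP: out => /far out; rewrite !out.
  by rewrite !sub0r; case: (val t =P _) => // <- _; rewrite mulN1r.
by rewrite !subr0; case: (val t =P _) => // <- _; rewrite mul1r.
Qed.

(** * The product with the multiplier and two Schur complements *)

Section Determinant.
Variables (G : lattice_graph) (f : 'I_3 -> edges G) (t : 'I_3 -> faces G).
Variables (a b : faces G) (I1 I2 : verts G) (X : verts G -> edges G -> int).
Hypothesis Gsquares : bounded_faces_are_squares G.
Hypothesis fouter : forall i, outer_edge G (val (f i)).
Hypothesis ft : forall i, val (f i) \in sides (val (t i)).
Hypothesis X_boundary : forall v u,
  \sum_e X v e * vert_sign (val u) (val e) = (u == v)%:R - (u == I1)%:R.
Hypothesis X_terminal : forall i, X I2 (f i) = 0.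

Local Notation inc := (incidence f a b I1 I2).
Local Notation theta := (theta X).

(** Entries of the transpose of [theta] times the incidence matrix. In the order faces (F), vertices
    (V), added columns (T), block FF is K, FV is 0, VV is the identity and TT is 0. *)
Definition gram (y y' : col_index G) : int := \sum_x theta x y * inc x y'.

Lemma gramFF x x' : (gram (inl x) (inl x'))%:~R = Kmx G (enum_rank x) (enum_rank x').
Proof.
rewrite -face_gram /gram sum_row /= [X in _ + X]big1 ?addr0 // => k _.
by rewrite mul0r.
Qed.

Lemma gramFV x v : gram (inl x) (inr (inl v)) = 0.
Proof.
rewrite /gram sum_row /= face_vert_orthogonal add0r big1 // => k _.
by rewrite mul0r.
Qed.

Lemma gramFT x i : gram (inl x) (inr (inr i)) =
  face_sign (val (t i)) (val (f i)) * (x == t i)%:R.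
Proof.
rewrite /gram sum_row /= [X in _ + X]big1 ?addr0 => [|k _]; last by rewrite mul0r.
by rewrite sum_delta (@terminal_sign _ _ (t i)) //; apply: ft.
Qed.

Lemma gramVF v x : gram (inr (inl v)) (inl x) = \sum_e X v e * face_sign (val x) (val e).
Proof.
rewrite /gram sum_row /= [X in _ + X]big1 ?addr0 // => k _.
by have [->|_] := eqVneq k 2%:R; rewrite ?mul0r.
Qed.

Lemma gramVV v v' : gram (inr (inl v)) (inr (inl v')) = (v' == v)%:R.
Proof.
rewrite /gram sum_row /= X_boundary.
(* The row pinning [I1] restores the starting point subtracted by the boundary of the path. *)
by rewrite !big_ord_recl big_ord0 /=; case: (v' == I1); rewrite /=; ring.
Qed.

Lemma gramVT v i : gram (inr (inl v)) (inr (inr i)) = X v (f i).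
Proof.
rewrite /gram sum_row /= [X in _ + X]big1 ?addr0 => [|k _]; last by rewrite mulr0.
by rewrite sum_delta.
Qed.

Lemma gramTF i x : gram (inr (inr i)) (inl x) =
  ((i == 0) && (x == a))%:R + ((i == 2%:R) && (x == b))%:R.
Proof.
rewrite /gram sum_row /= big1 ?add0r => [|k _]; last by rewrite mul0r.
by rewrite !big_ord_recl big_ord0 /=; case: i => -[|[|[|//]]] ?; case: (x == a);
  case: (x == b).
Qed.

Lemma gramTV i v : gram (inr (inr i)) (inr (inl v)) = ((i == 1) && (v == I2))%:R.
Proof.
rewrite /gram sum_row /= big1 ?add0r => [|k _]; last by rewrite mul0r.
by rewrite !big_ord_recl big_ord0 /=; case: i => -[|[|[|//]]] ?; case: (v == I1);
  case: (v == I2).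
Qed.

Lemma gramTT i j : gram (inr (inr i)) (inr (inr j)) = 0.
Proof.
rewrite /gram sum_row /= big1 ?add0r => [|k _]; last by rewrite mul0r.
by rewrite big1 // => k _; rewrite mulr0.
Qed.

Let nF := #|{: faces G}|.
Let nV := #|{: verts G}|.

Definition col_of (j : 'I_(nF + (nV + 3))) : col_index G :=
  match split j with
  | inl x => inl (enum_val x)
  | inr j' => match split j' with inl v => inr (inl (enum_val v)) | inr i => inr (inr i) end
  end.

Lemma col_of_bij : bijective col_of.
Proof.
pose g (y : col_index G) : 'I_(nF + (nV + 3)) := match y with
  | inl x => lshift _ (enum_rank x)
  | inr (inl v) => rshift _ (lshift _ (enum_rank v))
  | inr (inr i) => rshift _ (rshift _ i) end.
exists g => [j|y].
  rewrite /col_of; case: splitP => [x jx|j' jj'].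
    by apply: val_inj; rewrite /= enum_valK jx.
  case: splitP => [v jv|i ji]; apply: val_inj; rewrite /= ?enum_valK jj' ?jv ?ji //.
by rewrite /g /col_of; case: y => [x|[v|i]];
  rewrite ?(unsplitK (inl _)) ?(unsplitK (inr _)) ?(unsplitK (inl _)) ?(unsplitK (inr _))
  ?enum_rankK.
Qed.

Variable r : 'I_(nF + (nV + 3)) -> row_index G.
Hypothesis rbij : bijective r.

Let B : 'M[int]_(nF + (nV + 3)) := \matrix_(i, j) inc (r i) (col_of j).
Let T : 'M[int]_(nF + (nV + 3)) := \matrix_(i, j) theta (r i) (col_of j).

(** An integer matrix with an integer right inverse has determinant 1 or -1. *)
Lemma det_theta : `|\det T| = 1.
Proof.
have [psi psiE] := fin_all_exists (theta_surj Gsquares X_boundary).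
have : T *m (\matrix_(j, i) psi (r i) (col_of j)) = 1%:M.
  apply/matrixP => i j; rewrite !mxE; under eq_bigr => k _ do rewrite !mxE.
  rewrite -(reindex _ (onW_bij _ col_of_bij) (P := xpredT)
    (F := fun y => theta (r i) y * psi (r j) y)) /=.
  by rewrite psiE (inj_eq (bij_inj rbij)).
move/(congr1 determinant); rewrite det_mulmx det1 => h.
have := congr1 absz h; rewrite abszM => /eqP; rewrite muln_eq1 => /andP[/eqP hT _].
by rewrite -abszE hT.
Qed.

Let M : 'M[rat]_(nF + (nV + 3)) := map_mx intr (T^T *m B).

Lemma ME i j : M i j = (gram (col_of i) (col_of j))%:~R.
Proof.
rewrite !mxE /gram; congr (_%:~R); rewrite (reindex _ (onW_bij _ rbij)) /=.
by apply: eq_bigr => k _; rewrite !mxE.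
Qed.

Lemma norm_det_M : `|\det M| = `|\det B|%:~R.
Proof.
rewrite det_map_mx det_mulmx det_tr rmorphM normrM -!intr_norm det_theta mul1r.
by [].
Qed.

Lemma col_ofF k : col_of (lshift _ k) = inl (enum_val k).
Proof. by rewrite /col_of (unsplitK (inl _)). Qed.
Lemma col_ofV k : col_of (rshift _ (lshift _ k)) = inr (inl (enum_val k)).
Proof. by rewrite /col_of (unsplitK (inr _)) (unsplitK (inl _)). Qed.
Lemma col_ofT k : col_of (rshift _ (rshift _ k)) = inr (inr k).
Proof. by rewrite /col_of (unsplitK (inr _)) (unsplitK (inr _)). Qed.

Lemma ulM : ulsubmx M = Kmx G.
Proof. by apply/matrixP => i j; rewrite 2!mxE ME !col_ofF gramFF !enum_valK. Qed.

(** Row [y] of the face block times the inverse of K, read at [t i]: the correction made by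
    eliminating the faces, up to the sign [sg i] of the terminal edge. *)
Definition response (y : col_index G) (i : 'I_3) : rat :=
  \sum_x (gram y (inl x))%:~R * green x (t i).
Let sg i : rat := (face_sign (val (t i)) (val (f i)))%:~R.

Let D := drsubmx M - dlsubmx M *m invmx (ulsubmx M) *m ursubmx M.

Lemma DE i j : D i j = (gram (col_of (rshift _ i)) (col_of (rshift _ j)))%:~R -
  \sum_k \sum_l (gram (col_of (rshift _ i)) (inl (enum_val k)))%:~R *
    invmx (Kmx G) k l * (gram (inl (enum_val l)) (col_of (rshift _ j)))%:~R.
Proof.
have sub m1 m2 n1 n2 (N : 'M[rat]_(m1 + m2, n1 + n2)) :
  [/\ forall i j, drsubmx N i j = N (rshift _ i) (rshift _ j),
      forall i j, dlsubmx N i j = N (rshift _ i) (lshift _ j) &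
      forall i j, ursubmx N i j = N (lshift _ i) (rshift _ j)].
  by split=> i' j'; rewrite !mxE.
have [sdr sdl sur] := sub _ _ _ _ M.
rewrite /D ulM mxE [X in _ + X]mxE sdr ME [X in _ - X]mxE exchange_big /=.
congr (_ - _); apply: eq_bigr => l _; rewrite sur ME col_ofF mxE big_distrl /=.
by apply: eq_bigr => k _; rewrite sdl ME col_ofF.
Qed.

Lemma DV i k : D i (lshift _ k) = (gram (col_of (rshift _ i)) (inr (inl (enum_val k))))%:~R.
Proof.
rewrite DE col_ofV big1 ?subr0 // => l _; rewrite big1 // => l' _.
by rewrite gramFV mulr0.
Qed.

Lemma DT i k : D i (rshift _ k) = (gram (col_of (rshift _ i)) (inr (inr k)))%:~R
  - sg k * response (col_of (rshift _ i)) k.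
Proof.
rewrite DE col_ofT; congr (_ - _).
rewrite /response big_distrr (reindex _ (onW_bij _ (@enum_val_bij {: faces G}))) /=.
apply: eq_bigr => l _.
rewrite (bigD1 (enum_rank (t k))) //= big1 => [|l' lt].
  rewrite addr0 gramFT enum_rankK eqxx mulr1 /sg /green enum_valK; ring.
rewrite gramFT; case: eqP => [e|_]; last by rewrite !mulr0.
by rewrite -e enum_valK eqxx in lt.
Qed.

Lemma ulD : ulsubmx D = 1%:M.
Proof.
apply/matrixP => i j; have -> : ulsubmx D i j = D (lshift _ i) (lshift _ j) by rewrite !mxE.
by rewrite DV col_ofV gramVV mxE (inj_eq enum_val_inj) eq_sym mulrz_nat.
Qed.

(** What remains after eliminating faces and then vertices, with the column signs [sg] split off.
    The vertex block is the identity, and only [I2] is pinned by a remaining row, so only the path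
    to [I2] survives; it avoids the terminal edges. *)
Definition schur3 : 'M[rat]_3 := \matrix_(i, k)
  ((i == 1)%:R * response (inr (inl I2)) k - response (inr (inr i)) k).

Lemma drD : drsubmx D - dlsubmx D *m invmx (ulsubmx D) *m ursubmx D =
  schur3 *m diag_mx (\row_k sg k).
Proof.
rewrite ulD invmx1 mulmx1; apply/matrixP => i k; rewrite mul_mx_diag.
rewrite [RHS]mxE [schur3 i k]mxE [(\row_k sg k) 0 k]mxE.
rewrite [LHS]mxE [X in _ + X]mxE [X in _ - X]mxE.
have -> : drsubmx D i k = D (rshift _ i) (rshift _ k) by rewrite !mxE.
rewrite DT col_ofT gramTT sub0r (bigD1 (enum_rank I2)) //= big1 => [|v vI].
  have -> : dlsubmx D i (enum_rank I2) = D (rshift _ i) (lshift _ (enum_rank I2)).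
    by rewrite !mxE.
  have -> : ursubmx D (enum_rank I2) k = D (lshift _ (enum_rank I2)) (rshift _ k).
    by rewrite !mxE.
  rewrite DV DT col_ofT col_ofV enum_rankK gramTV gramVT X_terminal eqxx andbT.
  rewrite mulrz_nat; ring.
have -> : dlsubmx D i v = D (rshift _ i) (lshift _ v) by rewrite !mxE.
rewrite DV col_ofT gramTV; case: (enum_val v =P I2) => [e|_]; last by rewrite andbF mul0r.
by rewrite -e enum_valK eqxx in vI.
Qed.

Lemma det_incidence : `|\det B|%:~R = `|\det (Kmx G)| * `|\det schur3|.
Proof.
rewrite -norm_det_M det_schur ulM ?Kmx_unit // -ulM -/D.
rewrite (det_schur (M := D)) ?ulD ?unitmx1 // det1 mul1r -ulD drD det_mulmx det_diag.
rewrite !normrM normr_prod [X in _ * (_ * X)]big1 ?mulr1 ?ulM // => k _.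
rewrite mxE /sg -intr_norm; case: (face_sign_pm1 (ft k)) => -> //.
Qed.

End Determinant.

Lemma sum_boundary_cells (G : lattice_graph) (s : seq (point * point)) (F : faces G -> rat) :
  \sum_(x : faces G) (\sum_(d <- s) (val x == right_cell d)%:R) * F x =
  \sum_(y <- pmap insub [seq right_cell d | d <- s]) F y.
Proof.
elim: s => [|d s IH]; first by rewrite big1 ?big_nil // => x _; rewrite big_nil mul0r.
under eq_bigr => x _ do rewrite big_cons mulrDl.
rewrite big_split /= IH; under eq_bigr => x _ do rewrite mulrC.
rewrite sum_extend /extend; case: insubP => [x _ _|_] /=; first by rewrite big_cons.
by rewrite add0r.
Qed.

(** [ma] and [mb] are the multiplicities of [a] and [b] along [s]; in the determinant they amount to
    adding multiples of the outer rows to the middle one. *)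
Lemma sum_boundary_between (G : lattice_graph) (a b : faces G) (s : seq (point * point)) :
  exists ma mb : rat, forall F : faces G -> rat,
  \sum_(y <- pmap insub [seq right_cell d | d <- s]) F y =
  \sum_(y <- boundary_between a b s) F y + ma * F a + mb * F b.
Proof.
rewrite /boundary_between; elim: (pmap _ _) => [|y l [ma [mb IH]]].
  by exists 0, 0 => F; rewrite !big_nil; ring.
case: (eqVneq y a) => [->|ya].
  exists (ma + 1), mb => F; rewrite big_cons IH /= !inE eqxx /=; ring.
case: (eqVneq y b) => [->|yb].
  exists ma, (mb + 1) => F; rewrite big_cons IH /= !inE eqxx orbT /=; ring.
exists ma, mb => F; rewrite big_cons IH /= !inE (negbTE ya) (negbTE yb) /= big_cons; ring.
Qed.

Lemma det_corner_row (R : comPzRingType) (m1 m2 e : R) :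
  \det (\matrix_(i < 3, j < 3)
    (nth [::] [:: [:: -1; 0; 0]; [:: m1; e; m2]; [:: 0; 0; -1]] i)`_j) = e.
Proof.
rewrite (expand_det_row _ 0) !big_ord_recl big_ord0 /cofactor.
rewrite !mxE /= !mul0r !addr0 (expand_det_row _ (lift 0 0)).
rewrite !big_ord_recl big_ord0 /cofactor !mxE /=.
rewrite !det_mx11 !mxE /=.
by rewrite /bump /=; ring.
Qed.

Section Comparison.
Variables (G : lattice_graph) (f : 'I_3 -> edges G) (t : 'I_3 -> faces G).
Variables (a b : faces G) (I1 I2 : verts G) (X : verts G -> edges G -> int).
Variables (eps : bool) (s : seq (point * point)).
Hypothesis X_face : forall x : faces G, \sum_e X I2 e * face_sign (val x) (val e) =
        (-1) ^+ eps * \sum_(d <- s) (val x == right_cell d)%:R.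

Lemma norm_det_schur3 : `|\det (schur3 f t a b I1 I2 X)| =
  `|\det (\matrix_(r < 3, i < 3)
       [:: green a (t i);
           \sum_(y <- boundary_between a b s) green y (t i);
           green b (t i)]`_r)|.
Proof.
have [ma [mb msum]] := sum_boundary_between a b s.
set N := \matrix_(r, i) _.
pose sg : rat := (-1) ^+ eps.
(* Row operations with determinant [sg]: negate the outer rows, scale the middle one by [sg] and add
   multiples of the rows of [a] and [b] to it. *)
pose P : 'M[rat]_3 := \matrix_(i < 3, j < 3)
  (nth [::] [:: [:: -1; 0; 0]; [:: sg * ma; sg; sg * mb]; [:: 0; 0; -1]] i)`_j.
suff -> : schur3 f t a b I1 I2 X = P *m N.
  by rewrite det_mulmx normrM /P det_corner_row /sg normrX normrN1 expr1n mul1r.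
have rI k : response f t a b I1 I2 X (inr (inl I2)) k =
    sg * (\sum_(y <- boundary_between a b s) green y (t k) + ma * green a (t k)
          + mb * green b (t k)).
  rewrite -(msum (fun y => green y (t k))) -sum_boundary_cells big_distrr /=.
  apply: eq_bigr => x _; rewrite gramVF X_face rmorphM /= rmorphXn /= rmorphN1 mulrA.
  congr (_ * _ * _); rewrite rmorph_sum; apply: eq_bigr => d _; exact: mulrz_nat.
have rT i k : response f t a b I1 I2 X (inr (inr i)) k =
    (i == 0)%:R * green a (t k) + (i == 2%:R)%:R * green b (t k).
  rewrite /response -(sum_delta a (fun x => green x (t k))).
  rewrite -(sum_delta b (fun x => green x (t k))) !big_distrr -big_split /=.
  apply: eq_bigr => x _; rewrite gramTF rmorphD /= !mulrz_nat.
  by case: (i == 0); case: (i == 2%:R); case: (x == a); case: (x == b); rewrite /=; ring.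
apply/matrixP => i k; rewrite !mxE !big_ord_recl big_ord0 !mxE rI rT.
by case: i => -[|[|[|//]]] ? /=; ring.
Qed.

End Comparison.

(** * Matchings as permutations *)

Lemma set2_inj (T : finType) (x y z : T) : x != y -> [set x; y] = [set x; z] -> y = z.
Proof.
move=> xy /setP/(_ y); rewrite !inE eqxx orbT eq_sym (negbTE xy) /= => /esym/eqP.
by [].
Qed.

Section Matchings.
Variables (G : lattice_graph) (f : 'I_3 -> edges G) (a b : faces G) (I1 I2 : verts G).
Hypothesis finj : injective f.
Hypotheses (aI1 : val I1 \in corners (val a)) (bI2 : val I2 \in corners (val b)).
Hypotheses (ab : a != b) (I12 : I1 != I2).
Local Notation inc := (incidence f a b I1 I2).
Local Notation gv := (gvert G 3).

Definition gvert_col (y : col_index G) : gv :=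
  match y with
  | inl x => in_G1 3 x
  | inr (inl v) => in_G2 3 v
  | inr (inr i) => in_T G i
  end.
Let mid (e : edges G) : gv := in_mid 3 e.

Lemma gvert_col_inj : injective gvert_col.
Proof. by case=> [x|[v|i]] [x'|[v'|i']] //= [->]. Qed.

Lemma mid_neq_col e y : (mid e == gvert_col y) = false.
Proof. by case: y => [x|[v|i]]. Qed.

Lemma gvertP (x : gv) : (exists e, x = mid e) \/ (exists y, x = gvert_col y).
Proof.
case: x => [[[x|i]|v]|e]; [right|right|right|left].
- by exists (inl x).
- by exists (inr (inr i)).
- by exists (inr (inl v)).
- by exists e.
Qed.

Lemma gadj_mid e y : gadj f (mid e) (gvert_col y) = (inc (inl e) y != 0).
Proof.
case: y => [x|[v|i]] /=.
- by rewrite face_sign_side.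
- by rewrite vert_sign_end //; apply: edge_unit; apply: valP.
- by case: (e == f i).
Qed.

Lemma gedgeP E : E \in gedges f ->
  (exists e y, E = [set mid e; gvert_col y] /\ inc (inl e) y != 0) \/
  (exists x p, E = [set in_G1T x; in_G2 3 p]).
Proof.
case/imsetP => -[x y]; rewrite inE /= => xy ->.
case: (gvertP x) xy => [[e ->]|[z ->]].
  case: (gvertP y) => [[e' -> //]|[z ->]]; rewrite gadj_mid => ez.
  by left; exists e, z.
case: z => [z|[v|i]] //=; case: y => [[//|v]|//] h; right.
- by exists (inl z), v.
- by exists (inr i), v.
Qed.

Lemma gedge_mid e y : inc (inl e) y != 0 -> [set mid e; gvert_col y] \in gedges f.
Proof. by rewrite -gadj_mid => h; apply/imsetP; exists (mid e, gvert_col y); rewrite ?inE. Qed.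

Definition impurity1 : {set gv} := [set in_G1 3 a; in_G2 3 I1].
Definition impurity2 : {set gv} := [set in_G1 3 b; in_G2 3 I2].

(** Every edge of the graph other than the possible impurities ends at some [mid e], so a matching
    with given impurities is determined by the partner [h e] of each [mid e]. *)
Definition matching_of (h : edges G -> col_index G) : {set {set gv}} :=
  [set [set mid e; gvert_col (h e)] | e : edges G] :|: [set impurity1; impurity2].

Lemma matching_ofP h E : reflect
  ((exists e, E = [set mid e; gvert_col (h e)]) \/ E = impurity1 \/ E = impurity2)
  (E \in matching_of h).
Proof.
apply: (iffP setUP) => [[/imsetP[e _ ->]|/set2P[->|->]]|[[e ->]|[->|->]]].
- by left; exists e.
- by right; left.
- by right; right.
- by left; apply/imsetP; exists e.
- by right; rewrite !inE eqxx.
- by right; rewrite !inE eqxx orbT.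
Qed.

Lemma mid_impurity e : mid e \notin impurity1 /\ mid e \notin impurity2.
Proof. by rewrite !inE. Qed.

Lemma impurities_matching_of h :
  impurities (matching_of h) = [set impurity1; impurity2].
Proof.
apply/setP => E; rewrite [LHS]in_set in_set2; apply/andP/orP => [[/matching_ofP[[e ->]|[->|->]]]|].
- case/existsP=> x /existsP[p /eqP/setP/(_ (mid e))].
  by rewrite !inE eqxx.
- by rewrite eqxx; left.
- by rewrite eqxx; right.
case=> /eqP ->; split.
- by apply/matching_ofP; right; left.
- by apply/existsP; exists (inl a); apply/existsP; exists I1.
- by apply/matching_ofP; right; right.
- by apply/existsP; exists (inl b); apply/existsP; exists I2.
Qed.

Lemma matching_of_inj h h' : matching_of h = matching_of h' -> h =1 h'.
Proof.
move=> hh e; have : [set mid e; gvert_col (h e)] \in matching_of h'.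
  by rewrite -hh; apply/matching_ofP; left; exists e.
have mine : mid e \in [set mid e; gvert_col (h e)] by rewrite !inE eqxx.
have [m1 m2] := mid_impurity e.
case/matching_ofP => [[e' E]|[E|E]]; rewrite E ?(negbTE m1) ?(negbTE m2) // in mine.
move: mine; rewrite !inE mid_neq_col orbF => /eqP [ee]; subst e'.
by apply/gvert_col_inj; apply: set2_inj E; rewrite mid_neq_col.
Qed.

Definition row_col (h : edges G -> col_index G) (x : row_index G) : col_index G :=
  match x with
  | inl e => h e
  | inr k => nth (inl a) [:: inl a; inl b; inr (inl I1); inr (inl I2)] k
  end.

Lemma incidence_row_col h k : inc (inr k) (row_col h (inr k)) != 0.
Proof.
by case: k => -[|[|[|[|//]]]] ? //=; rewrite ?eqxx ?(eq_sym b) ?(eq_sym I2) ?(negbTE ab)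
  ?(negbTE I12).
Qed.

Lemma incidence_extra_eq h k y : inc (inr k) y != 0 -> y = row_col h (inr k).
Proof.
move=> h1; have s1 := incidence_extra ab I12 h1.
have s2 := incidence_extra ab I12 (incidence_row_col h k).
exact: (special_col_inj s1 s2).
Qed.

(** The row mapped by [row_col h] to a vertex tells which edge covers it: an ordinary edge for
    [inl e], an impurity for [inr k]. *)
Lemma perfect_matching_of h :
  (forall e, inc (inl e) (h e) != 0) -> bijective (row_col h) ->
  perfect_matching f (matching_of h).
Proof.
move=> hinc hbij; have [g gK Kg] := hbij.
apply/andP; split.
  apply/subsetP => E /matching_ofP[[e ->]|[->|->]]; first exact: gedge_mid.
    by apply/imsetP; exists (in_G1 3 a, in_G2 3 I1); rewrite ?inE.
  by apply/imsetP; exists (in_G1 3 b, in_G2 3 I2); rewrite ?inE.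
apply/forallP => x; apply/cards1P.
case: (gvertP x) => [[e ->]|[y ->]].
  exists [set mid e; gvert_col (h e)]; apply/setP => E; rewrite in_set in_set1.
  apply/andP/eqP => [[/matching_ofP[[e' ->]|[->|->]]]|->].
  - by rewrite !inE mid_neq_col orbF => /eqP [->].
  - by rewrite (negbTE (mid_impurity e).1).
  - by rewrite (negbTE (mid_impurity e).2).
  by split; [apply/matching_ofP; left; exists e|rewrite !inE eqxx].
have yg := Kg y.
have hrow e : h e = y -> g y = inl e by move=> <-; rewrite -[h e]/(row_col h (inl e)) gK.
case gy : (g y) => [e|k]; rewrite gy in yg hrow.
  exists [set mid e; gvert_col (h e)]; apply/setP => E; rewrite in_set in_set1.
  have notk k : y = row_col h (inr k) -> False.
    by rewrite -yg => /(bij_inj hbij).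
  apply/andP/eqP => [[/matching_ofP[[e' ->]|[->|->]]]|->].
  - rewrite !inE eq_sym mid_neq_col (inj_eq gvert_col_inj) => /eqP/esym/hrow.
    by case=> ->.
  - rewrite !inE => /orP[] /eqP yy; exfalso.
      by apply: (notk 0); apply: gvert_col_inj.
    by apply: (notk 2%:R); apply: gvert_col_inj.
  - rewrite !inE => /orP[] /eqP yy; exfalso.
      by apply: (notk 1); apply: gvert_col_inj.
    by apply: (notk 3%:R); apply: gvert_col_inj.
  split; first by apply/matching_ofP; left; exists e.
  by rewrite !inE -yg eqxx orbT.
have noth e : gvert_col y = gvert_col (h e) -> False.
  by move=> /gvert_col_inj/esym/hrow.
have only E : E \in matching_of h -> gvert_col y \in E -> E = impurity1 \/ E = impurity2.
  case/matching_ofP => [[e ->]|//]; rewrite !inE eq_sym mid_neq_col => /eqP/noth.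
  by [].
have abF : (b == a) = false by rewrite eq_sym (negbTE ab).
have IF : (I2 == I1) = false by rewrite eq_sym (negbTE I12).
(* Rows 0 and 2 pin the ends of the first impurity, rows 1 and 3 those of the second; the impurities
   are disjoint by [ab] and [I12]. *)
have [E0 [E0M yE0 uniq0]] : exists E0, [/\ E0 = impurity1 \/ E0 = impurity2,
    gvert_col y \in E0 & forall E, E = impurity1 \/ E = impurity2 -> gvert_col y \in E -> E = E0].
  have col1 v v' : (in_G2 3 v == in_G2 3 v' :> gv) = (v == v') by [].
  have col2 v v' : (in_G1 3 v == in_G1 3 v' :> gv) = (v == v') by [].
  rewrite -yg; case: k {yg gy hrow noth only} => -[|[|[|[|//]]]] kk /=.
  - exists impurity1; split; [by left|by rewrite !inE eqxx|move=> E [->//|->]].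
    by rewrite !inE col2 (negbTE ab).
  - exists impurity2; split; [by right|by rewrite !inE eqxx|move=> E [->|->//]].
    by rewrite !inE col2 abF.
  - exists impurity1; split; [by left|by rewrite !inE eqxx orbT|move=> E [->//|->]].
    by rewrite !inE col1 (negbTE I12).
  - exists impurity2; split; [by right|by rewrite !inE eqxx orbT|move=> E [->|->//]].
    by rewrite !inE col1 IF.
exists E0; apply/setP => E; rewrite in_set in_set1; apply/andP/eqP => [[EM yE]|->].
  by apply: uniq0 => //; apply: only.
by split=> //; apply/matching_ofP; right.
Qed.

(** Read [h e] off the edge covering [mid e]. A coincidence of values of [row_col h] would be a
    vertex covered twice. *)
Lemma matching_ex (M : {set {set gv}}) : M \in matchings_with_impurities f a b I1 I2 ->
  exists h, [/\ M = matching_of h, forall e, inc (inl e) (h e) != 0 &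
    injective (row_col h)].
Proof.
rewrite inE => /andP[/andP[/subsetP Msub /forallP Mcov] /eqP Mimp].
have uniqM x E E' : E \in M -> E' \in M -> x \in E -> x \in E' -> E = E'.
  move=> EM EM' xE xE'; have /cards1P[E0 /setP E0E] := Mcov x.
  have := E0E E; have := E0E E'; rewrite !inE EM EM' xE xE' /=.
  by move=> /esym/eqP -> /esym/eqP ->.
have impM E : E = impurity1 \/ E = impurity2 -> E \in M.
  have : E \in impurities M -> E \in M by rewrite inE => /andP[].
  by rewrite Mimp => h h'; apply: h; rewrite !inE; case: h' => ->; rewrite eqxx ?orbT.
have hex e : exists y, [set mid e; gvert_col y] \in M /\ inc (inl e) y != 0.
  have /cards1P[E0 /setP/(_ E0)] := Mcov (mid e); rewrite !inE eqxx => /andP[E0M eE0].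
  case: (gedgeP (Msub _ E0M)) => [[e' [y [E0E incy]]]|[x [p E0E]]]; last first.
    by move: eE0; rewrite E0E !inE.
  move: eE0; rewrite E0E !inE mid_neq_col orbF => /eqP [ee]; subst e'.
  by exists y; rewrite -E0E.
have [h hE] := fin_all_exists hex; exists h.
have hM e := (hE e).1; have hI e := (hE e).2.
split=> //.
  apply/setP => E; apply/idP/matching_ofP => [EM|[[e ->]|/impM]] //.
  case: (gedgeP (Msub _ EM)) => [[e [y [EE incy]]]|[x [p EE]]].
    left; exists e; apply: (uniqM (mid e)) => //; rewrite ?EE !inE eqxx //.
  right; have : E \in impurities M.
    rewrite inE EM; apply/existsP; exists x; apply/existsP; exists p; exact/eqP.
  by rewrite Mimp !inE => /orP[] /eqP ->; [left|right].
have noth e k : h e = row_col h (inr k) -> False.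
  have [m1 m2] := mid_impurity e.
  have [E [EI yE eE]] : exists E, [/\ E = impurity1 \/ E = impurity2,
      gvert_col (row_col h (inr k)) \in E & mid e \notin E].
    case: k => -[|[|[|[|//]]]] kk /=.
    - by exists impurity1; split; [left| rewrite !inE eqxx|].
    - by exists impurity2; split; [right| rewrite !inE eqxx|].
    - by exists impurity1; split; [left| rewrite !inE eqxx orbT|].
    - by exists impurity2; split; [right| rewrite !inE eqxx orbT|].
  move=> hek; rewrite -hek in yE.
  have eqE := uniqM _ _ _ (hM e) (impM _ EI) _ yE.
  by move: eE; rewrite -eqE ?inE ?eqxx ?orbT.
move=> [e|k] [e'|k'] //.
- rewrite /= => ee; congr inl.
  have : [set mid e; gvert_col (h e)] = [set mid e'; gvert_col (h e')].
    by apply: (uniqM (gvert_col (h e))) => //; rewrite ?ee !inE eqxx orbT.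
  move=> /setP/(_ (mid e)); rewrite !inE eqxx /=.
  by rewrite mid_neq_col orbF => /esym/eqP [].
- by move/noth.
- by move/esym/noth.
- move=> kk; have := incidence_extra ab I12 (incidence_row_col h k).
  rewrite kk (incidence_extra ab I12 (incidence_row_col h k')) => -[/val_inj ->].
  by [].
Qed.

Variables (n : nat) (r : 'I_n -> row_index G) (c : 'I_n -> col_index G).
Hypotheses (rbij : bijective r) (cbij : bijective c).

Lemma card_matchings : #|matchings_with_impurities f a b I1 I2| =
  #|[set s | supported f a b I1 I2 r c s]|.
Proof.
have [r' r'K rK] := rbij; have [c' c'K cK] := cbij.
pose hs (s : 'S_n) e := c (s (r' (inl e))).
have rc (s : 'S_n) : supported f a b I1 I2 r c s -> forall i, row_col (hs s) (r i) = c (s i).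
  move=> vs i; case ri: (r i) => [e|k] /=; first by rewrite /hs -ri r'K.
  by apply/esym/(@incidence_extra_eq (hs s)); rewrite -ri supportedP.
rewrite -(card_in_imset (f := fun s => matching_of (hs s))); last first.
  move=> s s'; rewrite !inE => vs vs' /matching_of_inj hh; apply/permP => i.
  apply: (bij_inj cbij); rewrite -(rc s vs) -(rc s' vs').
  by case: (r i) => [e|k] //=; apply: hh.
congr #|pred_of_set _|; apply/setP => M; apply/idP/imsetP => [|[s]].
  case/matching_ex => h [-> hI hinj].
  (* On a finite index set injectivity of [row_col h] suffices to obtain a permutation. *)
  have Hinj : injective (fun i => c' (row_col h (r i))).
    by apply: inj_comp (can_inj cK) _; apply: inj_comp hinj (bij_inj rbij).
  have hsE : hs (perm Hinj) =1 h by move=> e; rewrite /hs permE cK rK.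
  exists (perm Hinj).
    rewrite inE; apply/forallP => i; rewrite permE cK.
    by case: (r i) => [e|k]; [apply: hI|apply: incidence_row_col].
  apply/setP => E; apply/matching_ofP/matching_ofP => -[[e ->]|]; try by right.
    by left; exists e; rewrite hsE.
  by left; exists e; rewrite hsE.
rewrite inE => vs ->; rewrite inE impurities_matching_of eqxx andbT.
apply: perfect_matching_of => [e|].
  by have := supportedP (r' (inl e)) vs; rewrite rK.
exists (fun y => r ((s^-1)%g (c' y))) => [x|y].
  by rewrite -[x]rK rc // c'K permK.
by rewrite rc // permKV cK.
Qed.

End Matchings.

(** * The determinant formula for boundary impurities *)

Theorem theorem1p2 (G : lattice_graph)
  (Gconn : connected_graph G) (Gsquares : bounded_faces_are_squares G)
  (f : 'I_3 -> edges G) (t : 'I_3 -> faces G) (ft : terminals f t)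
  (a b : faces G) (I1 I2 : verts G)
  (a_bd : boundary_face a) (b_bd : boundary_face b)
  (I1_bd : outer_vertex G (val I1)) (I2_bd : outer_vertex G (val I2))
  (aI1 : val I1 \in corners (val a)) (bI2 : val I2 \in corners (val b))
  (ab : a != b) (I12 : I1 != I2)
  (s : seq (point * point))
  (s_portion : boundary_portion G (val I1) (val I2) s \/
               boundary_portion G (val I2) (val I1) s)
  (s_free : terminal_free f s) :
  (#|matchings_with_impurities f a b I1 I2|)%:R =
  `| \det (\matrix_(r < 3, i < 3)
       [:: green a (t i);
           \sum_(y <- boundary_between a b s) green y (t i);
           green b (t i)]`_r) * \det (Kmx G) |.
Proof.
have [finj fE] := ft.
have fouter i : outer_edge G (val (f i)) by case/andP: (fE i).
have fside i : val (f i) \in sides (val (t i)) by case/andP: (fE i).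
have [X [eps [X_boundary X_face X_off]]] := path_chains Gconn s_portion.
have X_terminal i : X I2 (f i) = 0 by apply: X_off => d /s_free; apply.
(* By Euler's formula the rows can be enumerated by the same ordinal as the block-ordered
   columns. *)
have size_eq : (#|{: faces G}| + (#|{: verts G}| + 3) = #|{: row_index G}|)%N.
  by rewrite (card_index Gsquares X_boundary) !card_sum card_ord.
pose r i : row_index G := enum_val (cast_ord size_eq i).
have rbij : bijective r.
  apply: bij_comp; first exact: enum_val_bij.
  by exists (cast_ord (esym size_eq)); [apply: cast_ordK|apply: cast_ordKV].
have cbij := col_of_bij G.
rewrite (card_matchings f aI1 bI2 ab I12 rbij cbij).
have := card_supported Gsquares finj fouter I1_bd I2_bd aI1 bI2 ab I12 rbij cbij.
move/(congr1 (intr : int -> rat)); rewrite /= rmorph_nat => ->.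
rewrite (det_incidence a b Gsquares fouter fside X_boundary X_terminal rbij).
by rewrite (norm_det_schur3 _ _ _ _ _ X_face) normrM mulrC.
Qed.
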